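(* Every algebraically maximal gdr field is a perfect, henselian and defectless field.
   Context: A valued field is algebraically maximal if it admits no nontrivial immediate algebraic extension. It is defectless if every finite extension $(L|K,v)$ satisfies $[L:K]=\sum_{i}(vL_i:vK)[L_iv:Kv]$ over the extensions of $v$ to $L$ (for henselian fields: $[L:K]=(vL:vK)[Lv:Kv]$). For a valued field $(K,v)$ with value group $vK$, residue field $Kv$, completion $\hat K$ with valuation ring $\mathcal{O}_{\hat K}$: (DRvr): if $\operatorname{char}Kv=p>0$, then $x\mapsto x^p$ is surjective on $\mathcal{O}_{\hat K}/p\mathcal{O}_{\hat K}$; (DRvp): if $\operatorname{char}Kv=p>0$, then $vp$ is not the smallest positive element of $vK$ ($vp=\infty$ if $\operatorname{char}K=p$). A gdr field is one satisfying (DRvr) and (DRvp). *)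

(* Defs.v *)
(* Valued fields are represented by their valuation rings:
   a valued field (K, v) is a field K together with a valuation ring O of K
   (a Prop-valued predicate).  The value group is K^x / O^x and the residue
   field is O / m; all notions below are the literal unfoldings of the
   standard definitions in terms of O. *)
From HB Require Import structures.
From mathcomp Require Import all_boot all_order all_algebra all_field.
Set Implicit Arguments. Unset Strict Implicit. Unset Printing Implicit Defensive.
Import GRing.Theory.
Local Open Scope ring_scope.

(* O is a valuation ring of K (the trivial valuation O = K is allowed). *)
Definition valuation_ring (K : fieldType) (O : K -> Prop) : Prop :=
  [/\ O 1, (forall x y, O x -> O y -> O (x - y)),
      (forall x y, O x -> O y -> O (x * y)) &
      (forall x, x != 0 -> O x \/ O x^-1)].

Definition vunit (K : fieldType) (O : K -> Prop) (x : K) : Prop :=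
  [/\ x != 0, O x & O x^-1].

Definition vmax (K : fieldType) (O : K -> Prop) (x : K) : Prop :=
  O x /\ ~ vunit O x.

Definition extends (K L : fieldType) (iota : K -> L)
    (O : K -> Prop) (OL : L -> Prop) : Prop :=
  forall a : K, OL (iota a) <-> O a.

Definition algebraic (K L : fieldType) (iota : {rmorphism K -> L}) : Prop :=
  forall y : L, exists p : {poly K}, p != 0 /\ root (map_poly iota p) y.

Definition immediate (K L : fieldType) (iota : K -> L)
    (O : K -> Prop) (OL : L -> Prop) : Prop :=
  (forall y : L, y != 0 -> exists a : K, a != 0 /\ vunit OL (y / iota a)) /\
  (forall y : L, OL y -> exists a : K, O a /\ vmax OL (y - iota a)).

Definition algebraically_maximal (K : fieldType) (O : K -> Prop) : Prop :=
  forall (L : fieldType) (iota : {rmorphism K -> L}) (OL : L -> Prop),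
    algebraic iota -> valuation_ring OL -> extends iota O OL ->
    immediate iota O OL -> forall y : L, exists a : K, y = iota a.

Definition henselian (K : fieldType) (O : K -> Prop) : Prop :=
  forall (L : fieldType) (iota : {rmorphism K -> L}), algebraic iota ->
    exists OL : L -> Prop,
      [/\ valuation_ring OL, extends iota O OL &
          forall OL' : L -> Prop, valuation_ring OL' -> extends iota O OL' ->
            forall y, OL' y <-> OL y].

Definition perfect (K : fieldType) : Prop :=
  forall p : nat, p \in [pchar K] -> forall x : K, exists y : K, y ^+ p = x.

Definition ram_index (K L : fieldType) (iota : K -> L)
    (OL : L -> Prop) (n : nat) : Prop :=
  exists y : 'I_n -> L,
    [/\ (forall i, y i != 0),
        (forall i j (a : K), a != 0 -> vunit OL (y i / (y j * iota a)) -> i = j) &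
        (forall z : L, z != 0 ->
           exists i (a : K), a != 0 /\ vunit OL (z / (y i * iota a)))].

(* [Lv : Kv] = n : residues of y_0..y_{n-1} form a basis of Lv over Kv *)
Definition res_degree (K L : fieldType) (iota : K -> L)
    (O : K -> Prop) (OL : L -> Prop) (n : nat) : Prop :=
  exists y : 'I_n -> L,
    [/\ (forall i, OL (y i)),
        (forall c : 'I_n -> K, (forall i, O (c i)) ->
           vmax OL (\sum_i iota (c i) * y i) -> forall i, vmax O (c i)) &
        (forall z : L, OL z -> exists c : 'I_n -> K,
           (forall i, O (c i)) /\ vmax OL (z - \sum_i iota (c i) * y i))].

Definition defectless (K : fieldType) (O : K -> Prop) : Prop :=
  forall L : fieldExtType K,
    let iota := fun a : K => (a%:A : L) in
    exists (k : nat) (OLs : 'I_k -> (L -> Prop)) (e f : 'I_k -> nat),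
      [/\ (forall i, [/\ valuation_ring (OLs i), extends iota O (OLs i),
                        ram_index iota (OLs i) (e i) &
                        res_degree iota O (OLs i) (f i)]),
          (forall i j, (forall x, OLs i x <-> OLs j x) -> i = j),
          (forall OL' : L -> Prop, valuation_ring OL' -> extends iota O OL' ->
             exists i, forall x, OL' x <-> OLs i x) &
          \dim {:L} = (\sum_i e i * f i)%N].

Definition proper_filter (L : Type) (F : (L -> Prop) -> Prop) : Prop :=
  [/\ F (fun _ => True), ~ F (fun _ => False),
      (forall A B, F A -> F B -> F (fun x => A x /\ B x)) &
      (forall A B : L -> Prop, (forall x, A x -> B x) -> F A -> F B)].

Definition cauchy (L : fieldType) (OL : L -> Prop) (F : (L -> Prop) -> Prop) :=
  proper_filter F /\
  forall c : L, c != 0 -> exists A, F A /\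
    forall x y, A x -> A y -> vmax OL ((x - y) / c).

Definition converges (L : fieldType) (OL : L -> Prop)
    (F : (L -> Prop) -> Prop) (l : L) : Prop :=
  forall c : L, c != 0 -> F (fun x => vmax OL ((x - l) / c)).

Definition complete (L : fieldType) (OL : L -> Prop) : Prop :=
  forall F, cauchy OL F -> exists l, converges OL F l.

Definition is_completion (K Kh : fieldType) (iota : {rmorphism K -> Kh})
    (O : K -> Prop) (Oh : Kh -> Prop) : Prop :=
  [/\ valuation_ring Oh, extends iota O Oh,
      (forall (y c : Kh), c != 0 -> exists a : K, vmax Oh ((y - iota a) / c)) &
      complete Oh].

Definition residue_char (K : fieldType) (O : K -> Prop) (p : nat) : Prop :=
  prime p /\ vmax O p%:R.

Definition DRvr (K : fieldType) (O : K -> Prop) : Prop :=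
  forall p : nat, residue_char O p ->
    exists (Kh : fieldType) (iota : {rmorphism K -> Kh}) (Oh : Kh -> Prop),
      is_completion iota O Oh /\
      forall x : Kh, Oh x -> exists y z : Kh,
        [/\ Oh y, Oh z & x - y ^+ p = p%:R * z].

(* (DRvp): vp is not the smallest positive element of vK
   (if p = 0 in K then vp = oo, which is not in vK) *)
Definition DRvp (K : fieldType) (O : K -> Prop) : Prop :=
  forall p : nat, residue_char O p ->
    ~ (p%:R != 0 :> K /\
       forall x : K, vmax O x -> x != 0 -> O (x / p%:R)).

Definition gdr (K : fieldType) (O : K -> Prop) : Prop := DRvr O /\ DRvp O.

(* Main.v *)
(** Algebraic maximality says that [v (alpha - K)] has a maximum for every algebraic alpha;
    everything rests on improving approximations by elements of K.

    Perfectness: the completion is perfect by (DRvr), so [K(x^(1/p))] is immediate.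
    Henselianity: if the conjugates of some x had different values, the product b of those of
    least value would be closer to K than to its other conjugates, and the traces of b and of
    [1 / (b - y)] would improve any approximation y of b.

    Defectlessness: it suffices to find, in each finite Galois extension N, a K-basis [w] with
    [v (sum a_i w_i) = min v (a_i w_i)].  Let O0 be the coarsening of the valuation ring in which
    p becomes invertible.  Its residue characteristic is 0 (or O0 is trivial), so over the fixed
    field E of its inertia group N is totally tamely ramified for O0, and such a basis comes from
    independence of characters; moreover E and K have the same O0-values.  In E the tame part T
    has such a basis for the same reason.  By (DRvr) and (DRvp), elements of K that are units of
    O0 are p-th powers up to 1-units; hence symmetric functions of the conjugates of a give an
    approximation of a in K as good as a is close to its conjugates.  Through the dual basis of
    T this carries over to approximation in T, which forces the ramification group to be
    trivial, i.e. E = T. *)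

(* Residue fields and value groups are never built: [unit1 O (x / y)] says that x and y have the
   same leading term, and all comparisons are made modulo the maximal ideal. Two obstacles shape the
   last part. When p is not 0, (DRvr) approximates b by a p-th power only modulo p, which fixes the
   leading term only if v b < v p. (DRvp) splits p into two factors of smaller value, and products
   then reach all units of the coarsening O0, but nothing beyond. Hence the detour through a field E
   whose elements can be scaled by K to such units. Secondly, best approximations are available in K
   only, as T is not known to be algebraically maximal. An approximation in T is therefore assembled
   from approximations in K of traces against a dual basis; that basis comes from a matrix
   invertible over the valuation ring, so no precision is lost. A valuation basis is found only in
   Galois extensions N. It leaves no room for a defect in N, and comparing degrees in the tower from
   K through L to N settles an arbitrary finite L. *)
Require Import Defs.
From HB Require Import structures.
From mathcomp Require Import all_boot all_order all_fingroup all_algebra all_solvable all_field.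
From mathcomp Require Import boolp ring zify.
From mathcomp Require classical_sets.
Set Implicit Arguments. Unset Strict Implicit. Unset Printing Implicit Defensive.
Import GRing.Theory.
Local Open Scope ring_scope.

(** * Divisibility preorder of a valuation ring *)

(* [vle O x y] says v x <= v y, and [vlt O x y] says v x < v y, where v is the
   valuation with ring O; in particular v 0 is the largest value. *)
Definition vle (L : fieldType) (O : L -> Prop) (x y : L) : Prop :=
  exists2 c, O c & y = c * x.

Definition vlt (L : fieldType) (O : L -> Prop) (x y : L) : Prop := ~ vle O y x.

Section Valuation.

Variables (L : fieldType) (O : L -> Prop).
Hypothesis vO : valuation_ring O.
Implicit Types x y z : L.

Lemma vring1 : O 1. Proof. by case: vO. Qed.

Lemma vringB x y : O x -> O y -> O (x - y). Proof. by case: vO => _ + _ _; apply. Qed.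

Lemma vringM x y : O x -> O y -> O (x * y). Proof. by case: vO => _ _ + _; apply. Qed.

Lemma vring0 : O 0. Proof. by rewrite -(subrr 1); apply: vringB; apply: vring1. Qed.

Lemma vringN x : O x -> O (- x).
Proof. by move=> Ox; rewrite -sub0r; apply: vringB => //; apply: vring0. Qed.

Lemma vringD x y : O x -> O y -> O (x + y).
Proof. by move=> Ox Oy; rewrite -[y]opprK; apply/vringB/vringN. Qed.

Lemma vring_sum (I : Type) (r : seq I) (P : pred I) F :
  (forall i, P i -> O (F i)) -> O (\sum_(i <- r | P i) F i).
Proof. move=> h; apply: (big_ind O) => //; [exact: vring0 | exact: vringD]. Qed.

Lemma vring_prod (I : Type) (r : seq I) (P : pred I) F :
  (forall i, P i -> O (F i)) -> O (\prod_(i <- r | P i) F i).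
Proof. move=> h; apply: (big_ind O) => //; [exact: vring1 | exact: vringM]. Qed.

Lemma vringX x n : O x -> O (x ^+ n).
Proof.
by move=> Ox; elim: n => [|n IH]; [exact: vring1 | rewrite exprS; apply: vringM].
Qed.

Lemma vring_nat n : O n%:R.
Proof.
elim: n => [|n IH]; first exact: vring0.
by rewrite -natr1; apply: vringD => //; apply: vring1.
Qed.

Lemma vringV x : x != 0 -> O x \/ O x^-1. Proof. by case: vO => _ _ _; apply. Qed.

Lemma vle_refl x : vle O x x. Proof. by exists 1; [exact: vring1 | rewrite mul1r]. Qed.

Lemma vle_trans y x z : vle O x y -> vle O y z -> vle O x z.
Proof.
by move=> [c Oc ->] [d Od ->]; exists (d * c); [exact: vringM | rewrite mulrA].
Qed.

Lemma vle0 x : vle O x 0. Proof. by exists 0; [exact: vring0 | rewrite mul0r]. Qed.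

Lemma vle0l x : vle O 0 x -> x = 0. Proof. by case=> c _ ->; rewrite mulr0. Qed.

Lemma vle_total x y : vle O x y \/ vle O y x.
Proof.
have [->|x0] := eqVneq x 0; first by right; apply: vle0.
have [->|y0] := eqVneq y 0; first by left; apply: vle0.
have [h|h] := vringV (mulf_neq0 x0 (invr_neq0 y0)).
  by right; exists (x / y); rewrite // divfK.
by left; exists (x / y)^-1; rewrite // invf_div divfK.
Qed.

Lemma vle_divE x y : x != 0 -> vle O x y <-> O (y / x).
Proof.
move=> x0; split=> [[c Oc ->]|h]; first by rewrite mulfK.
by exists (y / x); rewrite ?divfK.
Qed.

Lemma vle1E x : O x <-> vle O 1 x.
Proof. by rewrite vle_divE ?oner_neq0 // divr1. Qed.

Lemma vring_vle x : O x -> vle O 1 x. Proof. by move/vle1E. Qed.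

Lemma vle_vring x : vle O 1 x -> O x. Proof. by move/vle1E. Qed.

Lemma vleD z x y : vle O z x -> vle O z y -> vle O z (x + y).
Proof.
by move=> [c Oc ->] [d Od ->]; exists (c + d); [exact: vringD | rewrite mulrDl].
Qed.

Lemma vleN z x : vle O z x -> vle O z (- x).
Proof. by move=> [c Oc ->]; exists (- c); [exact: vringN | rewrite mulNr]. Qed.

Lemma vleNl z x : vle O z x -> vle O (- z) x.
Proof. by move=> [c Oc ->]; exists (- c); [exact: vringN | rewrite mulrNN]. Qed.

Lemma vleB z x y : vle O z x -> vle O z y -> vle O z (x - y).
Proof. by move=> zx zy; apply/vleD/vleN. Qed.

Lemma vle_sum z (I : Type) (r : seq I) (P : pred I) F :
  (forall i, P i -> vle O z (F i)) -> vle O z (\sum_(i <- r | P i) F i).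
Proof. move=> h; apply: (big_ind (vle O z)) => //; [exact: vle0 | exact: vleD]. Qed.

Lemma vleM x y z t : vle O x y -> vle O z t -> vle O (x * z) (y * t).
Proof.
by move=> [c Oc ->] [d Od ->]; exists (c * d); [exact: vringM | rewrite mulrACA].
Qed.

Lemma vleMl x y c : vle O x y -> vle O (c * x) (c * y).
Proof. by apply: vleM; apply: vle_refl. Qed.

Lemma vleMr x y c : vle O x y -> vle O (x * c) (y * c).
Proof. by move=> h; apply: vleM => //; apply: vle_refl. Qed.

Lemma vleM2r x y c : c != 0 -> vle O (x * c) (y * c) -> vle O x y.
Proof.
by move=> c0 /(vleMr c^-1); rewrite !mulfK.
Qed.

Lemma vleV x y : y != 0 -> vle O x y -> vle O y^-1 x^-1.
Proof.
move=> y0 [c Oc e]; rewrite e in y0 *; exists c => //.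
have c0 : c != 0 by apply: contraNneq y0 => ->; rewrite mul0r.
by rewrite invfM mulrA mulfV // mul1r.
Qed.

Lemma vlt_le x y : vlt O x y -> vle O x y.
Proof. by move=> h; case: (vle_total x y). Qed.

Lemma vltVle x y : vlt O x y \/ vle O y x.
Proof. by case: (pselect (vle O y x)); [right | left]. Qed.

Lemma vlt_neq0 x y : vlt O x y -> x != 0.
Proof. by move=> h; apply/eqP=> e; apply: h; rewrite e; apply: vle0. Qed.

Lemma vlt0 x : x != 0 -> vlt O x 0.
Proof. by move=> x0 /vle0l e; rewrite e eqxx in x0. Qed.

Lemma vlt_irr x : ~ vlt O x x. Proof. by apply; apply: vle_refl. Qed.

Lemma vlt_le_trans y x z : vlt O x y -> vle O y z -> vlt O x z.
Proof. by move=> h1 h2 h3; apply: h1; apply: vle_trans h3. Qed.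

Lemma vle_lt_trans y x z : vle O x y -> vlt O y z -> vlt O x z.
Proof. by move=> h1 h2 h3; apply: h2; apply: vle_trans h1. Qed.

Lemma vltD z x y : vlt O z x -> vlt O z y -> vlt O z (x + y).
Proof.
move=> zx zy; have [h|h] := vle_total x y.
  by apply: vlt_le_trans zx _; apply: vleD => //; apply: vle_refl.
by apply: vlt_le_trans zy _; apply: vleD => //; apply: vle_refl.
Qed.

Lemma vltN z x : vlt O z x -> vlt O z (- x).
Proof. by move=> h /vleNl; rewrite opprK. Qed.

Lemma vlt_sum z (I : Type) (r : seq I) (P : pred I) F : z != 0 ->
  (forall i, P i -> vlt O z (F i)) -> vlt O z (\sum_(i <- r | P i) F i).
Proof. move=> z0 h; apply: (big_ind (vlt O z)) => //; [exact: vlt0 | exact: vltD]. Qed.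

Lemma vltMr x y c : c != 0 -> vlt O x y -> vlt O (x * c) (y * c).
Proof. by move=> c0 h /(vleM2r c0). Qed.

Lemma vltMl x y c : c != 0 -> vlt O x y -> vlt O (c * x) (c * y).
Proof. by rewrite ![c * _]mulrC; apply: vltMr. Qed.

Lemma vlt_leM x y z t : z != 0 -> vlt O x y -> vle O z t -> vlt O (x * z) (y * t).
Proof. by move=> z0 xy zt; apply: vlt_le_trans (vltMr z0 xy) _; apply: vleMl. Qed.

Lemma vle_ltM x y z t : x != 0 -> vle O x y -> vlt O z t -> vlt O (x * z) (y * t).
Proof. by move=> x0 xy zt; rewrite [x * _]mulrC [y * _]mulrC; apply: vlt_leM. Qed.

Lemma vltV x y : y != 0 -> vlt O x y -> vlt O y^-1 x^-1.
Proof.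
by move=> y0 h /(vleV (invr_neq0 y0)); rewrite !invrK.
Qed.

Lemma vmaxE x : vmax O x <-> vlt O 1 x.
Proof.
split=> [[Ox nu] [c Oc /esym e]|h].
  have x0 : x != 0 by apply/eqP=> x0; move/eqP: e; rewrite x0 mulr0 eq_sym oner_eq0.
  by apply: nu; split=> //; rewrite -[x^-1]mul1r -e mulfK.
split; first by apply/vle1E/vlt_le.
by case=> x0 Ox Ox'; apply: h; exists x^-1; rewrite ?mulVf.
Qed.

Lemma vmax_divE x y : x != 0 -> vlt O x y <-> vmax O (y / x).
Proof.
move=> x0; rewrite vmaxE; split.
  by move/(vltMr (invr_neq0 x0)); rewrite mulfV.
by move/(vltMr x0); rewrite mul1r divfK.
Qed.

Lemma vunitE x : vunit O x <-> vle O 1 x /\ vle O x 1.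
Proof.
split=> [[x0 Ox Ox']|[/vle1E Ox xl]].
  by split; [apply/vle1E | exists x^-1; rewrite ?mulVf].
have x0 : x != 0.
  by apply/eqP=> e; move: xl; rewrite e => /vle0l /eqP; rewrite oner_eq0.
by split=> //; move/vle_divE: xl => /(_ x0); rewrite mul1r.
Qed.

Lemma vmax_ring x : vmax O x -> O x. Proof. by case. Qed.

Lemma vmax0 : vmax O 0. Proof. by apply/vmaxE/vlt0/oner_neq0. Qed.

Lemma vmaxNV1 : ~ vmax O 1. Proof. by move/vmaxE/vlt_irr. Qed.

Lemma vmaxD x y : vmax O x -> vmax O y -> vmax O (x + y).
Proof. by rewrite !vmaxE; apply: vltD. Qed.

Lemma vmaxN x : vmax O x -> vmax O (- x). Proof. by rewrite !vmaxE; apply: vltN. Qed.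

Lemma vmaxB x y : vmax O x -> vmax O y -> vmax O (x - y).
Proof. by move=> hx hy; apply/vmaxD/vmaxN. Qed.

Lemma vmaxMl x y : O x -> vmax O y -> vmax O (x * y).
Proof.
move=> /vle1E hx /vmaxE hy; apply/vmaxE; rewrite -[1]mul1r.
by apply: vle_ltM => //; apply: oner_neq0.
Qed.

Lemma vmaxMr x y : vmax O x -> O y -> vmax O (x * y).
Proof. by rewrite mulrC => hx hy; apply: vmaxMl. Qed.

Lemma vmax_sum (I : Type) (r : seq I) (P : pred I) F :
  (forall i, P i -> vmax O (F i)) -> vmax O (\sum_(i <- r | P i) F i).
Proof. move=> h; apply: (big_ind (vmax O)) => //; [exact: vmax0 | exact: vmaxD]. Qed.

Lemma vring_maxVunit x : O x -> vmax O x \/ vunit O x.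
Proof. by move=> Ox; case: (pselect (vunit O x)); [right | left]. Qed.

Lemma vunit_neq0 x : vunit O x -> x != 0. Proof. by case. Qed.

Lemma vunitM x y : vunit O x -> vunit O y -> vunit O (x * y).
Proof.
case=> x0 Ox Ox' [y0 Oy Oy']; split; [exact: mulf_neq0 | exact: vringM |].
by rewrite invfM; apply: vringM.
Qed.

Lemma vunitV x : vunit O x -> vunit O x^-1.
Proof. by case=> x0 Ox Ox'; split; rewrite ?invr_neq0 ?invrK. Qed.

Lemma vunit1 : vunit O 1.
Proof. by split; rewrite ?oner_neq0 ?invr1 //; apply: vring1. Qed.

Lemma vmaxX x n : O x -> vmax O (x ^+ n) -> vmax O x.
Proof.
move=> Ox h; case: (vring_maxVunit Ox) => // u; case: h => _ []; elim: n => [|n IH].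
  exact: vunit1.
by rewrite exprS; apply: vunitM.
Qed.

Lemma vmaxM_prime x y : O x -> O y -> vmax O (x * y) -> vmax O x \/ vmax O y.
Proof.
move=> Ox Oy [_ h]; case: (vring_maxVunit Ox) => hx; first by left.
by case: (vring_maxVunit Oy) => hy; [right | case: h; apply: vunitM].
Qed.

(** If v x were negative, x^-1 would lie in O and multiply x^(n+2) down to x^(n+1), so the exponent
    can be lowered to 1. *)
Lemma vring_expr x n : (0 < n)%N -> O (x ^+ n) -> O x.
Proof.
case: n => // n _ h; case: (vltVle x 1) => [xl|/vle1E //].
have x0 := vlt_neq0 xl; elim: n h => [|n IH]; first by rewrite expr1.
move=> h; apply: IH.
have e : x ^+ n.+1 = x^-1 * x ^+ n.+2 by rewrite [x ^+ n.+2]exprS mulKf.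
rewrite e; apply: vringM => //; case: (vringV x0) => // Ox.
by case: xl; apply/vle1E.
Qed.

Lemma vle_eqr x y z : vle O z (x - y) -> vle O z x -> vle O z y.
Proof.
move=> h hx; have -> : y = x - (x - y) by ring.
exact: vleB.
Qed.

Lemma vlt_subl x y : vlt O x (x - y) -> vle O x y /\ vle O y x.
Proof.
move=> h; have xy : vle O x y by apply: vle_eqr (vlt_le h) (vle_refl _).
split=> //; case: (vltVle x y) => // lt; case: (@vlt_irr x).
by rewrite -[X in vlt _ _ X](subrK y); apply: vltD.
Qed.

Lemma vlt_subC x y z : vlt O z (x - y) -> vlt O z (y - x).
Proof. by move/vltN; rewrite opprB. Qed.

Lemma ex_vmin (I : eqType) (r : seq I) (F : I -> L) i0 : i0 \in r ->
  exists2 i, i \in r & forall j, j \in r -> vle O (F i) (F j).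
Proof.
elim: r i0 => // a r IH i0 _; case: r IH => [_|b r IH].
  by exists a; rewrite ?mem_head // => j; rewrite inE => /eqP->; apply: vle_refl.
case: (IH b (mem_head _ _)) => i ir im; case: (vle_total (F a) (F i)) => h.
  exists a; first exact: mem_head.
  move=> j; rewrite inE => /orP[/eqP->|jr]; first exact: vle_refl.
  by apply: vle_trans h (im _ jr).
by exists i; [rewrite inE ir orbT | move=> j; rewrite inE => /orP[/eqP->//|/im]].
Qed.

Lemma vmax_subM x x' y y' : O x -> O x' -> O y -> O y' ->
  vmax O (x - x') -> vmax O (y - y') -> vmax O (x * y - x' * y').
Proof.
move=> Ox Ox' Oy Oy' hx hy.
have -> : x * y - x' * y' = x * (y - y') + (x - x') * y'.
  by rewrite mulrBr mulrBl addrA subrK.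
by apply: vmaxD; [apply: vmaxMl | apply: vmaxMr].
Qed.

End Valuation.

(** * 1-units and equality of leading terms *)

(** The group 1 + m. A quotient x / y in it is the multiplicative form of v (x - y) > v y, which
    unlike the difference is compatible with products and powers. *)
Definition unit1 (L : fieldType) (O : L -> Prop) (u : L) : Prop := vmax O (u - 1).

Section OneUnits.

Variables (L : fieldType) (O : L -> Prop).
Hypothesis vO : valuation_ring O.
Implicit Types u w x y : L.

Lemma unit11 : unit1 O 1. Proof. by rewrite /unit1 subrr; apply: vmax0. Qed.

Lemma unit1_ring u : unit1 O u -> O u.
Proof. by move/vmax_ring => h; rewrite -[u](subrK 1); apply: vringD => //; apply: vring1. Qed.

Lemma unit1_unit u : unit1 O u -> vunit O u.
Proof.
move=> h; case: (vring_maxVunit (unit1_ring h)) => // hu.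
case: (vmaxNV1 vO); have -> : 1 = u - (u - 1) by ring.
exact: vmaxB.
Qed.

Lemma unit1_neq0 u : unit1 O u -> u != 0. Proof. by move/unit1_unit/vunit_neq0. Qed.

Lemma unit1M u w : unit1 O u -> unit1 O w -> unit1 O (u * w).
Proof.
move=> hu hw; rewrite /unit1 -[X in _ - X]mul1r.
by apply: vmax_subM => //; try exact: vring1; apply: unit1_ring.
Qed.

Lemma unit1V u : unit1 O u -> unit1 O u^-1.
Proof.
move=> hu; have [u0 _ Ou'] := unit1_unit hu.
rewrite /unit1.
have -> : u^-1 - 1 = - (u^-1 * (u - 1)) by rewrite mulrBr mulVf // mulr1 opprB.
by apply/vmaxN => //; apply: vmaxMl.
Qed.

Lemma unit1_prod (I : Type) (r : seq I) (P : pred I) F :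
  (forall i, P i -> unit1 O (F i)) -> unit1 O (\prod_(i <- r | P i) F i).
Proof. move=> h; apply: (big_ind (unit1 O)) => //; [exact: unit11 | exact: unit1M]. Qed.

Lemma unit1X u n : unit1 O u -> unit1 O (u ^+ n).
Proof. by move=> h; elim: n => [|n IH]; [exact: unit11 | rewrite exprS; exact: unit1M]. Qed.

Lemma unit1_divE x y : y != 0 -> unit1 O (x / y) <-> vlt O y (x - y).
Proof. by move=> y0; rewrite /unit1 (vmax_divE vO) // mulrBl mulfV. Qed.

Lemma unit1_div_trans y x z : y != 0 -> unit1 O (x / y) -> unit1 O (y / z) -> unit1 O (x / z).
Proof. by move=> y0 h1 h2; have := unit1M h1 h2; rewrite mulrA divfK. Qed.

Lemma unit1_div_sym x y : unit1 O (x / y) -> unit1 O (y / x).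
Proof. by move/unit1V; rewrite invf_div. Qed.

(* Frobenius is injective on the residue field. *)
Lemma unit1_root p k w : prime p -> vmax O p%:R -> unit1 O (w ^+ (p ^ k)) -> unit1 O w.
Proof.
move=> pr pm; elim: k w => [|k IH] w; first by rewrite expr1.
rewrite expnSr exprM => h; apply: IH; move: (w ^+ (p ^ k)) h => {}w h.
have Ow : O w.
  by apply: vring_expr (prime_gt0 pr) _ => //; apply: unit1_ring.
rewrite /unit1; apply: (@vmaxX _ _ vO _ p) => //.
  by apply: vringB => //; apply: vring1.
have p_gt0 := prime_gt0 pr.
(* The inner binomial terms are multiples of p, so (w - 1)^p agrees with w^p - 1 modulo p. *)
have -> : (w - 1) ^+ p = (w ^+ p - 1) + ((w - 1) ^+ p - w ^+ p + 1).
  by ring.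
apply: vmaxD => //.
suff : exists2 c, O c & (w - 1) ^+ p - w ^+ p + 1 = p%:R * c.
  by case=> c Oc ->; apply: vmaxMr.
rewrite exprBn; case: p pr pm p_gt0 {h} => // p pr pm _.
rewrite big_ord_recl big_ord_recr /= subn0 bin0 expr0 !mulr1n mul1r !expr1n !mulr1.
rewrite [bump 0 p]/bump leq0n add1n subnn binn mulr1n expr0 mulr1; set S := \sum_(i < p) _.
have [c Oc ->] : exists2 c, O c & S = p.+1%:R * c.
  apply: (big_ind (fun s => exists2 c, O c & s = p.+1%:R * c)).
  - by exists 0; rewrite ?mulr0 //; apply: vring0.
  - move=> _ _ [c Oc ->] [d Od ->]; exists (c + d); rewrite ?mulrDr //.
    exact: vringD.
  move=> i _; rewrite /bump /= add1n.
  have /dvdnP[q ->] : (p.+1 %| 'C(p.+1, i.+1))%N.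
    by apply: prime_dvd_bin => //; apply: (ltn_ord i).
  exists ((-1) ^+ i.+1 * w ^+ (p.+1 - i.+1) * 1 ^+ i.+1 * q%:R).
    do 3?apply: vringM => //; try exact: vringX; try exact: vring_nat.
      by apply: vringX => //; apply: vringN => //; apply: vring1.
    by rewrite expr1n; apply: vring1.
  by rewrite -mulr_natr natrM mulrA mulrC.
have -> : w ^+ p.+1 + (p.+1%:R * c + (-1) ^+ p.+1) - w ^+ p.+1 + 1 =
    p.+1%:R * c + ((-1) ^+ p.+1 + 1).
  by ring.
(* The end terms cancel for odd p; for p = 2 they add up to 2, again a multiple of p. *)
case: (even_prime pr) => [->|od].
  exists (c + 1); first by apply: vringD => //; apply: vring1.
  by rewrite sqrrN expr1n mulrDr mulr1.
by exists c => //; rewrite -signr_odd od expr1 addNr addr0.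
Qed.

End OneUnits.

(** * Extension of valuations *)

(** The pairs of Chevalley's extension theorem: a subring with a proper ideal. In a pair that cannot
    be enlarged the subring is a valuation ring. *)
Definition subring_ideal (L : fieldType) (R P : L -> Prop) : Prop :=
  [/\ [/\ R 1, forall x y, R x -> R y -> R (x - y) & forall x y, R x -> R y -> R (x * y)],
      [/\ P 0, forall x y, P x -> P y -> P (x - y) & forall x y, R x -> P y -> P (x * y)],
      (forall x, P x -> R x) & ~ P 1].

Lemma exprBV (L : fieldType) (d : L) i n :
  d != 0 -> (i <= n)%N -> d ^+ n * d^-1 ^+ i = d ^+ (n - i).
Proof.
by move=> d0 le; rewrite -{1}(subnK le) exprD -mulrA -exprMn mulfV // expr1n mulr1.
Qed.

Section MaximalPair.

Variables (L : fieldType) (R P : L -> Prop).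
Hypothesis RP : subring_ideal R P.
Hypothesis RPmax : forall R' P', subring_ideal R' P' ->
  (forall x, R x -> R' x) -> (forall x, P x -> P' x) -> forall x, R' x -> R x.

Let R1 : R 1. Proof. by case: RP => [[]]. Qed.
Let RB x y : R x -> R y -> R (x - y). Proof. by case: RP => [[_ h _] _ _ _]; apply: h. Qed.
Let RM x y : R x -> R y -> R (x * y). Proof. by case: RP => [[_ _ h] _ _ _]; apply: h. Qed.
Let P0 : P 0. Proof. by case: RP => [_ []]. Qed.
Let PB x y : P x -> P y -> P (x - y). Proof. by case: RP => [_ [_ h _] _ _]; apply: h. Qed.
Let PM x y : R x -> P y -> P (x * y). Proof. by case: RP => [_ [_ _ h] _ _]; apply: h. Qed.
Let PR x : P x -> R x. Proof. by case: RP => _ _ + _; apply. Qed.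
Let P1 : ~ P 1. Proof. by case: RP. Qed.
Let R0 : R 0. Proof. exact: PR. Qed.
Let PD x y : P x -> P y -> P (x + y).
Proof. by move=> hx hy; rewrite -[y]opprK -[- y]sub0r; apply/PB/PB. Qed.
Let RD x y : R x -> R y -> R (x + y).
Proof. by move=> hx hy; rewrite -[y]opprK -[- y]sub0r; apply/RB/RB. Qed.
Let Psum (I : Type) (r : seq I) (Q : pred I) F :
  (forall i, Q i -> P (F i)) -> P (\sum_(i <- r | Q i) F i).
Proof. by move=> h; apply: (big_ind P). Qed.
Let Rsum (I : Type) (r : seq I) (Q : pred I) F :
  (forall i, Q i -> R (F i)) -> R (\sum_(i <- r | Q i) F i).
Proof. by move=> h; apply: (big_ind R). Qed.
Let RX x n : R x -> R (x ^+ n).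
Proof. by move=> h; elim: n => [|n IH]; rewrite ?expr0 ?exprS //; apply: RM. Qed.

(** Unless 1 lies in P[x], the pair R[x], P[x] is again admissible, and maximality puts x into R. *)
Lemma maximal_pair_adjoin x :
  ~ (exists2 f : {poly L}, (forall i, P f`_i) & f.[x] = 1) -> R x.
Proof.
move=> nP.
apply: (RPmax (R' := fun y => exists2 f : {poly L}, (forall i, R f`_i) & y = f.[x])
              (P' := fun y => exists2 f : {poly L}, (forall i, P f`_i) & y = f.[x])).
- split; [split|split| |].
  + by exists 1; [move=> i; rewrite coef1; case: (i == _) | rewrite hornerC].
  + move=> _ _ [f hf ->] [g hg ->]; exists (f - g); last by rewrite hornerD hornerN.
    by move=> i; rewrite coefB; apply: RB.
  + move=> _ _ [f hf ->] [g hg ->]; exists (f * g); last by rewrite hornerM.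
    by move=> i; rewrite coefM; apply: Rsum => j _; apply: RM.
  + by exists 0; [move=> i; rewrite coef0 | rewrite horner0].
  + move=> _ _ [f hf ->] [g hg ->]; exists (f - g); last by rewrite hornerD hornerN.
    by move=> i; rewrite coefB; apply: PB.
  + move=> _ _ [f hf ->] [g hg ->]; exists (f * g); last by rewrite hornerM.
    by move=> i; rewrite coefM; apply: Psum => j _; apply: PM.
  + by move=> _ [f hf ->]; exists f => // i; apply/PR.
  + by case=> f hf e; apply: nP; exists f.
- by move=> y Ry; exists y%:P; [move=> i; rewrite coefC; case: ifP | rewrite hornerC].
- by move=> y Py; exists y%:P; [move=> i; rewrite coefC; case: ifP | rewrite hornerC].
by exists 'X; [move=> i; rewrite coefX; case: (i == _) | rewrite hornerX].
Qed.

(** If 1 = f(1 / (1 - b)) with f over P, clearing denominators puts a power of 1 - b into P,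
    although all these powers are 1 modulo P. *)
Lemma maximal_pair_unit b : P b -> R (1 - b)^-1.
Proof.
move=> Pb; have b1 : 1 - b != 0 by rewrite subr_eq0; apply/eqP=> e; apply: P1; rewrite e.
apply: maximal_pair_adjoin => -[f hf e]; apply: P1.
have h n : P (1 - (1 - b) ^+ n).
  elim: n => [|n IH]; first by rewrite expr0 subrr.
  have -> : 1 - (1 - b) ^+ n.+1 = (1 - (1 - b) ^+ n) + (1 - b) ^+ n * b.
    by rewrite exprS; ring.
  by apply: PD => //; apply: PM => //; apply: RX; apply: RB => //; apply: PR.
have -> : (1 : L) = (1 - (1 - b) ^+ size f) + (1 - b) ^+ size f by rewrite subrK.
apply: PD => //; rewrite -[X in P X]mulr1 -[X in _ * X]e horner_coef mulr_sumr.
apply: Psum => i _.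
have -> : (1 - b) ^+ size f * (f`_i * (1 - b)^-1 ^+ i) = (1 - b) ^+ (size f - i) * f`_i.
  by rewrite mulrCA (exprBV b1 (ltnW (ltn_ord i))) mulrC.
by apply: PM => //; apply: RX; apply: RB => //; apply: PR.
Qed.

(** Otherwise there are relations 1 = f(x) and 1 = g(1/x) over P. The shorter one shortens the
    longer one, and this descent on the total length never ends. *)
Lemma maximal_pair_inv x : x != 0 -> R x \/ R x^-1.
Proof.
move=> x0; apply: contrapT => /not_orP[n1 n2].
have [f hf ef] : exists2 f : {poly L}, (forall i, P f`_i) & f.[x] = 1.
  by apply: contrapT => /maximal_pair_adjoin.
have [g hg eg] : exists2 g : {poly L}, (forall i, P g`_i) & g.[x^-1] = 1.
  by apply: contrapT => /maximal_pair_adjoin.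
have [N leN] : exists N, (size f + size g < N)%N by exists (size f + size g).+1.
elim: N x x0 {n1 n2} f g hf hg ef eg leN => // N IH x x0 f g hf hg ef eg leN.
wlog le_gf : x x0 f g hf hg ef eg leN / (size g <= size f)%N.
  move=> W; case/orP: (leq_total (size g) (size f)) => h; first exact: (W x _ f g).
  by apply: (W x^-1 _ g f) => //; rewrite ?invr_neq0 ?invrK // addnC.
have f_gt0 : (0 < size f)%N.
  rewrite lt0n size_poly_eq0; apply/eqP=> f0.
  by move/eqP: ef; rewrite f0 horner0 eq_sym oner_eq0.
set n := (size f).-1; have en : size f = n.+1 by rewrite prednK.
have b1 : 1 - g`_0 != 0 by rewrite subr_eq0; apply/eqP=> e; apply: P1; rewrite e.
pose a := f`_n; pose c := (1 - g`_0)^-1.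
(* From 1 = g(1/x) one gets x^n (1 - g_0) = sum of g_i x^(n-i) over i > 0, which replaces the
   leading term of f. No negative power occurs because size g <= size f. *)
pose f' := \poly_(i < n) (f`_i + a * c * g`_(n - i)).
have hf' i : P f'`_i.
  rewrite coef_poly; case: ifP => // _; apply: PD => //; apply: PM => //.
  by apply: RM; [exact: PR (hf n) | exact: maximal_pair_unit (hg 0%N)].
apply: (IH x x0 f' g) => //; last first.
  rewrite ltnS in leN; apply: leq_trans leN; rewrite ltn_add2r en ltnS; exact: size_poly.
rewrite horner_poly -ef (horner_coef f) en big_ord_recr /=.
under eq_bigr do rewrite mulrDl.
rewrite big_split /=; congr (_ + _).
have legn : (size g <= n.+1)%N by rewrite -en.
have := eg; rewrite (horner_coef_wide _ legn) big_ord_recl /= expr0 mulr1 => e1.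
transitivity (a * c * (x ^+ n * (1 - g`_0))); last first.
  by rewrite -mulrA (mulrCA c) mulVf // mulr1.
rewrite -e1 addrAC subrr add0r !mulr_sumr (reindex_inj rev_ord_inj) /=.
apply: eq_bigr => i _; rewrite subKn // -mulrA; congr (_ * _).
rewrite mulrCA /bump leq0n add1n; congr (_ * _).
by rewrite exprBV.
Qed.

Lemma maximal_pair_valuation : valuation_ring R.
Proof. by split=> // x; apply: maximal_pair_inv. Qed.

End MaximalPair.

(** Zorn's lemma applied to pairs over the image of O and of its maximal ideal. Keeping the ideal
    proper is what stops R from swallowing more of K: for a outside O, a^-1 is in the ideal, so a in
    R would put 1 there. *)
Lemma valuation_extends (K L : fieldType) (iota : {rmorphism K -> L}) (O : K -> Prop) :
  valuation_ring O -> exists OL, valuation_ring OL /\ extends iota O OL.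
Proof.
move=> vO.
pose good (RP : (L -> Prop) * (L -> Prop)) := [/\ subring_ideal RP.1 RP.2,
  forall a, O a -> RP.1 (iota a) & forall a, vmax O a -> RP.2 (iota a)].
pose le (s t : {RP | good RP}) := `[< (forall x, (sval s).1 x -> (sval t).1 x) /\
  (forall x, (sval s).2 x -> (sval t).2 x) >].
have good0 : good (fun y => exists2 a, O a & y = iota a,
                   fun y => exists2 a, vmax O a & y = iota a).
  split=> /=; [split; [split|split| |] | by move=> a h; exists a | by move=> a h; exists a].
  - by exists 1; rewrite ?rmorph1 //; apply: vring1.
  - by move=> _ _ [a ha ->] [b hb ->]; exists (a - b); rewrite ?rmorphB //; apply: vringB.
  - by move=> _ _ [a ha ->] [b hb ->]; exists (a * b); rewrite ?rmorphM //; apply: vringM.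
  - by exists 0; rewrite ?rmorph0 //; apply: vmax0.
  - by move=> _ _ [a ha ->] [b hb ->]; exists (a - b); rewrite ?rmorphB //; apply: vmaxB.
  - by move=> _ _ [a ha ->] [b hb ->]; exists (a * b); rewrite ?rmorphM //; apply: vmaxMl.
  - by move=> _ [a ha ->]; exists a => //; apply: vmax_ring.
  - by case=> a ha /esym/eqP; rewrite fmorph_eq1 => /eqP e; apply: (vmaxNV1 vO); rewrite -e.
have [] := @classical_sets.ZL_preorder _ (exist _ _ good0) le.
- by move=> t; apply/asboolP.
- move=> r s t /asboolP[h1 h2] /asboolP[h3 h4].
  by apply/asboolP; split=> x hx; [apply/h3/h1 | apply/h4/h2].
- move=> A totA.
  case: (pselect (exists s, A s)) => [[s0 As0]|nA]; last first.
    by exists (exist _ _ good0) => s As; case: nA; exists s.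
  have chain s t : A s -> A t -> exists2 u, A u & le s u /\ le t u.
    move=> As At; case: (totA s t As At) => h; [exists t | exists s] => //;
      by split=> //; apply/asboolP.
  pose R x := exists2 s, A s & (sval s).1 x; pose P x := exists2 s, A s & (sval s).2 x.
  have gRP : good (R, P).
    split=> /=.
    + split; [split|split| |].
      * by exists s0 => //; case: (svalP s0) => [[[]]].
      * move=> x y [s As hx] [t At hy]; have [u Au [/asboolP[su _] /asboolP[tu _]]] := chain s t As At.
        by exists u => //; case: (svalP u) => [[[_ h _] _ _ _] _ _]; apply: h; [apply: su|apply: tu].
      * move=> x y [s As hx] [t At hy]; have [u Au [/asboolP[su _] /asboolP[tu _]]] := chain s t As At.
        by exists u => //; case: (svalP u) => [[[_ _ h] _ _ _] _ _]; apply: h; [apply: su|apply: tu].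
      * by exists s0 => //; case: (svalP s0) => [[_ []]].
      * move=> x y [s As hx] [t At hy]; have [u Au [/asboolP[_ su] /asboolP[_ tu]]] := chain s t As At.
        by exists u => //; case: (svalP u) => [[_ [_ h _] _ _] _ _]; apply: h; [apply: su|apply: tu].
      * move=> x y [s As hx] [t At hy]; have [u Au [/asboolP[su _] /asboolP[_ tu]]] := chain s t As At.
        by exists u => //; case: (svalP u) => [[_ [_ _ h] _ _] _ _]; apply: h; [apply: su|apply: tu].
      * by move=> x [s As hx]; exists s => //; case: (svalP s) => [[_ _ h _] _ _]; apply: h.
      * by case=> s As h; case: (svalP s) => [[_ _ _ []]].
    + by move=> a Oa; exists s0 => //; case: (svalP s0) => _ h _; apply: h.
    + by move=> a Oa; exists s0 => //; case: (svalP s0) => _ _ h; apply: h.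
  by exists (exist _ _ gRP) => s As; apply/asboolP; split=> x hx; exists s.
case=> [[R P] [/= RP OR mP]] mx; exists R.
have mxRP R' P' : subring_ideal R' P' ->
  (forall x, R x -> R' x) -> (forall x, P x -> P' x) -> forall x, R' x -> R x.
  move=> RP' h1 h2.
  have g' : good (R', P') by split=> //= a h; [apply/h1/OR | apply/h2/mP].
  by have /asboolP[] : le (exist _ _ g') (exist _ (R, P) (And3 RP OR mP));
    [apply: mx; apply/asboolP | ].
split; first exact: maximal_pair_valuation RP mxRP.
move=> a; split=> [Ra|]; last exact: OR.
have [//|nOa] := pselect (O a).
have a0 : a != 0 by apply/eqP=> e; apply: nOa; rewrite e; apply: vring0.
case: (RP) => _ [_ _ PM] _ []; have -> : 1 = iota a * iota a^-1 by rewrite -rmorphM mulfV ?rmorph1.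
apply: PM => //; apply: (mP); split; first by case: (vringV vO a0).
by case=> _ _; rewrite invrK.
Qed.

(** * Splitting fields *)

Lemma ex_irreducible_factor (F : fieldType) (f : {poly F}) :
  (1 < size f)%N -> exists2 r, r %| f & irreducible_poly r.
Proof.
move=> f_gt1.
have exn : exists n, `[< exists r : {poly F}, [/\ r %| f, (1 < size r)%N & size r = n] >].
  by exists (size f); apply/asboolP; exists f.
case: (ex_minnP exn) => n /asboolP[r [rf r_gt1 sz]] mn; exists r => //; split=> // q q1 qr.
have r0 : r != 0 by rewrite -size_poly_gt0 ltnW.
have q0 : q != 0 by apply: contraTneq qr => ->; rewrite dvd0p.
rewrite -dvdp_size_eqp // eqn_leq dvdp_leq //= sz; apply: mn; apply/asboolP.
exists q; split=> //; first exact: dvdp_trans rf.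
by rewrite ltn_neqAle eq_sym q1 size_poly_gt0.
Qed.

Lemma fieldExt_root (K : fieldType) (L : fieldExtType K) (f : {poly L}) :
  (1 < size f)%N -> exists (M : fieldExtType K) (j : {rmorphism L -> M}),
    (forall a, j a%:A = a%:A) /\ exists z, root (map_poly j f) z.
Proof.
move=> /ex_irreducible_factor[r rf /irredp_FAdjoin[M _ [z rz _]]].
exists (baseFieldType M), (in_alg M); split.
  by move=> a; rewrite baseField_scaleE.
by exists z; rewrite -(divpK rf) rmorphM rootM rz orbT.
Qed.

Lemma fieldExt_split (K : fieldType) (L : fieldExtType K) (f : {poly L}) :
  f != 0 -> exists (M : fieldExtType K) (j : {rmorphism L -> M}),
    (forall a, j a%:A = a%:A) /\
    exists rs, map_poly j f %= \prod_(z <- rs) ('X - z%:P).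
Proof.
have [n le_n] := ubnP (size f); elim: n L f le_n => // n IH L f; rewrite ltnS => le_n f0.
have [f1|f_gt1] := leqP (size f) 1.
  exists L, idfun; split=> //; exists [::]; rewrite big_nil map_poly_id //.
  by rewrite -size_poly_eq1 eqn_leq f1 size_poly_gt0.
have [M [j [jA [z /factor_theorem[q eq_f]]]]] := fieldExt_root f_gt1.
have f0' : map_poly j f != 0 by rewrite map_poly_eq0.
have q0 : q != 0 by apply: contraNneq f0' => q0; rewrite eq_f q0 mul0r.
have szq : (size q < n)%N.
  apply: leq_trans le_n; rewrite -(size_map_poly j) eq_f size_Mmonic ?monicXsubC //.
  by rewrite size_XsubC addn2.
have [M' [j' [jA' [rs hrs]]]] := IH M q szq q0.
exists M', (j' \o j)%FUN; split; first by move=> a /=; rewrite jA jA'.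
exists (j' z :: rs); rewrite map_poly_comp eq_f rmorphM /= big_cons mulrC.
by rewrite map_polyXsubC eqp_mul2l // polyXsubC_eq0.
Qed.

(** * Comparison of a valuation with its extensions *)

Section Extends.

Variables (K E : fieldType) (iota : {rmorphism K -> E}) (O : K -> Prop) (OE : E -> Prop).
Hypotheses (vO : valuation_ring O) (eOE : extends iota O OE).

Lemma extendsE a : OE (iota a) = O a. Proof. exact/propext/eOE. Qed.

Lemma extends_vunit a : vunit OE (iota a) = vunit O a.
Proof. by rewrite /vunit -fmorphV fmorph_eq0 !extendsE. Qed.

Lemma extends_vmax a : vmax OE (iota a) = vmax O a.
Proof. by rewrite /vmax extends_vunit extendsE. Qed.

Lemma extends_unit1 a : unit1 OE (iota a) = unit1 O a.
Proof. by rewrite /unit1 -(rmorph1 iota) -rmorphB extends_vmax. Qed.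

Lemma extends_vle a b : vle OE (iota a) (iota b) = vle O a b.
Proof.
apply/propext; split=> [[c Oc e]|[c Oc ->]]; last first.
  by exists (iota c); rewrite ?extendsE ?rmorphM.
have [a0|a0] := eqVneq a 0.
  move/eqP: e; rewrite a0 rmorph0 mulr0 fmorph_eq0 => /eqP->.
  exact: vle0.
exists (b / a); last by rewrite divfK.
by rewrite -extendsE fmorph_div e mulfK // fmorph_eq0.
Qed.

Lemma extends_vlt a b : vlt OE (iota a) (iota b) = vlt O a b.
Proof. by rewrite /vlt extends_vle. Qed.

End Extends.

Lemma extends_comp (K E F : fieldType) (iota : {rmorphism K -> E}) (j : {rmorphism E -> F})
    O OE OF : extends iota O OE -> extends j OE OF -> extends (j \o iota) O OF.
Proof. by move=> h1 h2 a; rewrite /= h2 h1. Qed.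

(** * Best approximations from an algebraically maximal field *)

Section BestApproximation.

Variables (K : fieldType) (O : K -> Prop).
Hypothesis vO : valuation_ring O.
Hypothesis amO : algebraically_maximal O.

(** The hypothesis says that every nonzero element of K(alpha) has its leading term in K. This makes
    K(alpha) immediate over K, hence equal to K. *)
Lemma amax_simple (E : fieldType) (iota : {rmorphism K -> E}) (OE : E -> Prop)
    (f : {poly K}) alpha :
  valuation_ring OE -> extends iota O OE -> f != 0 -> root (map_poly iota f) alpha ->
  (forall g : {poly K}, (map_poly iota g).[alpha] != 0 ->
    exists2 a, a != 0 & unit1 OE ((map_poly iota g).[alpha] / iota a)) ->
  exists a, alpha = iota a.
Proof.
move=> vE eE f0 fa claim.
(* [subFExtend] realises K(alpha) for any nonzero f vanishing at alpha, irreducible or not. *)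
pose L0 := subFExtend iota alpha f.
pose i0 : {rmorphism K -> L0} := inj_subfx iota alpha f.
pose j0 : {rmorphism L0 -> E} := subfx_inj.
have j0i a : j0 (i0 a) = iota a by rewrite /j0 /i0 /= subfx_inj_eval // map_polyC hornerC.
pose OL x := OE (j0 x).
have vL : valuation_ring OL.
  split; rewrite /OL; first by rewrite rmorph1; apply: vring1.
  - by move=> x y; rewrite rmorphB; apply: vringB.
  - by move=> x y; rewrite rmorphM; apply: vringM.
  - by move=> x x0; rewrite fmorphV; apply: vringV => //; rewrite fmorph_eq0.
have eL : extends i0 O OL by move=> a; rewrite /OL j0i.
have ej : extends j0 OL OE by [].
have mL x : vmax OL x <-> vmax OE (j0 x) by rewrite (extends_vmax ej).
have elt (x : L0) : x != 0 -> exists2 a, a != 0 & unit1 OE (j0 x / iota a).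
  have [q ->] := subfxE x; rewrite -(fmorph_eq0 j0) /j0 /= !subfx_inj_eval //.
  exact: claim.
have alg : algebraic i0.
  move=> x; have [q ->] := subfxE x.
  have : algebraicOver i0 (subfx_eval iota alpha f q).
    have -> : subfx_eval iota alpha f q = (map_poly i0 q).[subfx_root iota alpha f].
      apply: (fmorph_inj j0); rewrite -horner_map -map_poly_comp /= /j0 subfx_inj_root //.
      by rewrite subfx_inj_eval //; congr (_.[_]); apply: eq_map_poly => a; rewrite /= -j0i.
    have rz : algebraicOver i0 (subfx_root iota alpha f).
      exists f => //; rewrite -(fmorph_root j0) -map_poly_comp /= /j0 subfx_inj_root //.
      by rewrite (eq_map_poly (g := iota)) // => a; rewrite /= -j0i.
    elim/poly_ind: q => [|q c IHq].
      by rewrite rmorph0 horner0 -(rmorph0 i0); apply: algebraic_id.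
    rewrite rmorphD rmorphM /= map_polyX map_polyC !hornerE.
    by apply: algebraic_add; [apply: algebraic_mul | apply: algebraic_id].
  by case=> p p0 rp; exists p.
have imm : immediate i0 O OL.
  split=> y.
    move=> y0; have [a a0 u] := elt y y0; exists a; split=> //.
    by have := unit1_unit vE u; rewrite -j0i -fmorph_div (extends_vunit ej).
  have [->|y0] := eqVneq y 0.
    by exists 0; split; [apply: vring0 | rewrite rmorph0 subrr; apply: vmax0].
  move=> Oy; have [a a0 u] := elt y y0.
  have ia0 : iota a != 0 by rewrite fmorph_eq0.
  have Oa : O a.
    rewrite -(extendsE eE); have [_ _ h] := unit1_unit vE u; rewrite invf_div in h.
    have y0' : j0 y != 0 by rewrite fmorph_eq0.
    by rewrite -(divfK y0' (iota a)); apply: vringM.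
  exists a; split=> //; apply/mL; rewrite rmorphB j0i.
  have -> : j0 y - iota a = (j0 y / iota a - 1) * iota a by rewrite mulrBl divfK ?mul1r.
  by apply: vmaxMr => //; rewrite (extendsE eE).
have [a ea] := amO alg vL eL imm (subfx_root iota alpha f).
exists a; have : j0 (subfx_root iota alpha f) = iota a by rewrite ea j0i.
by rewrite /j0 /= subfx_inj_root.
Qed.

(* If [v (alpha - K)] has no maximum and all elements of smaller degree have a best
   approximation, then [g alpha / g y] is a 1-unit for y close to alpha, whenever g has
   degree below that of alpha; hence [K(alpha)] is an immediate extension of K. *)
Lemma ex_best_approx (E : fieldType) (iota : {rmorphism K -> E}) (OE : E -> Prop)
    (f : {poly K}) alpha :
  valuation_ring OE -> extends iota O OE -> f != 0 -> root (map_poly iota f) alpha ->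
  exists y0, forall y, vle OE (alpha - iota y) (alpha - iota y0).
Proof.
have [n le_n] := ubnP (size f).
elim: n E iota OE f alpha le_n => // n IH E iota OE f alpha; rewrite ltnS => le_n vE eE f0 fa.
apply: contrapT => nmax.
have H y0 : exists y, vlt OE (alpha - iota y0) (alpha - iota y).
  apply: contrapT => h; apply: nmax; exists y0 => y.
  by case: (vltVle OE (alpha - iota y0) (alpha - iota y)) => // lt; case: h; exists y.
have claim (g : {poly K}) : g != 0 -> (size g < size f)%N ->
    exists2 y, g.[y] != 0 & unit1 OE ((map_poly iota g).[alpha] / iota g.[y]).
  move=> g0 szg.
  have g0' : map_poly iota g != 0 :> {poly E^o} by rewrite map_poly_eq0.
  have [M [j [_ [rs hrs]]]] := fieldExt_split g0'.
  have [OM [vM eM]] := valuation_extends j vE.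
  pose iM : {rmorphism K -> M} := (j \o iota)%FUN.
  have eKM : extends iM O OM by apply: extends_comp eM.
  have jlt x y : vlt OE x y <-> vlt OM (j x) (j y).
    by rewrite (extends_vlt vE eM).
  have groot r : r \in rs -> root (map_poly iM g) r.
    move=> rrs; rewrite /iM map_poly_comp; have /eqp_root -> := hrs.
    by rewrite root_prod_XsubC.
  (* Otherwise alpha is closer to r than to every element of K, so both have the same distances to
     K, and a best approximation of r, known by induction, would be one of alpha. *)
  have near r : r \in rs -> exists y, vlt OM (j alpha - r) (j alpha - iM y).
    move=> rrs; apply: contrapT => h.
    have lt y : vlt OM (j alpha - iM y) (j alpha - r).
      have [y' lty] := H y.
      have /jlt := lty; rewrite !rmorphB /= => /(vlt_le_trans vM); apply.
      by case: (vltVle OM (j alpha - r) (j alpha - iM y')) => // ?; case: h; exists y'.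
    have [y0 hy0] := IH M iM OM g r (leq_trans szg le_n) vM eKM g0 (groot r rrs).
    have [y1 lty] := H y0; have le := hy0 y1.
    have e x : vle OM (r - iM x) (j alpha - iM x) /\ vle OM (j alpha - iM x) (r - iM x).
      have [] := @vlt_subl _ _ vM (j alpha - iM x) (r - iM x) => //.
      by rewrite opprB addrA subrK; apply: lt.
    have /jlt := lty; rewrite !rmorphB /=; apply.
    exact (vle_trans vM (e y1).2 (vle_trans vM le (e y0).1)).
  have [y hy] : exists y, forall r, r \in rs -> vlt OM (j alpha - r) (j alpha - iM y).
    elim: rs near {hrs groot} => [|r rs IHr] near; first by exists 0.
    have [|y1 h1] := IHr; first by move=> r' hr'; apply: near; rewrite inE hr' orbT.
    have [y2 h2] := near r (mem_head _ _).
    have [le|le] := vle_total vM (j alpha - iM y1) (j alpha - iM y2).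
      exists y2 => r'; rewrite inE => /orP[/eqP->//|/h1 h].
      exact: vlt_le_trans h le.
    exists y1 => r'; rewrite inE => /orP[/eqP->|/h1//].
    exact: vlt_le_trans h2 le.
  have /eqpf_eq[c c0 ec] := hrs.
  have ev x : j (map_poly iota g).[x] = c * \prod_(r <- rs) (j x - r).
    rewrite -horner_map ec hornerZ horner_prod.
    by congr (_ * _); apply: eq_bigr => r _; rewrite !hornerE.
  have ry r : r \in rs -> unit1 OM ((j alpha - r) / (iM y - r)).
    move=> /hy lt; have a0 := vlt_neq0 vM lt.
    apply: unit1_div_sym => //; apply/unit1_divE => //.
    have -> : iM y - r - (j alpha - r) = - (j alpha - iM y) by ring.
    exact: vltN.
  have ryn r : r \in rs -> iM y - r != 0.
    by move=> /ry /(unit1_neq0 vM); rewrite mulf_eq0 invr_eq0 negb_or => /andP[].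
  have gy0 : g.[y] != 0.
    rewrite -(fmorph_eq0 iM) /= -horner_map ev mulf_eq0 negb_or c0 /=.
    rewrite prodf_seq_neq0; apply/allP => r rrs /=; exact: ryn.
  exists y => //; suff : unit1 OM (j ((map_poly iota g).[alpha] / iota g.[y])).
    by rewrite (extends_unit1 eM).
  rewrite fmorph_div /= -(horner_map iota) /= !ev -mulf_div mulfV // mul1r.
  rewrite -prodf_div big_seq_cond; apply: unit1_prod => // r /andP[rrs _].
  exact: ry.
have [|a ea] := amax_simple vE eE f0 fa.
  move=> g; rewrite {1 2}(divp_eq g f) !rmorphD !rmorphM /= !hornerE (rootP fa) mulr0 add0r => q0.
  case: (claim (g %% f)); [|by rewrite ltn_modp|by move=> y; exists (g %% f).[y]].
  by apply: contraNneq q0 => ->; rewrite rmorph0 horner0.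
by have [y] := H a; rewrite ea subrr => /(vlt_neq0 vE); rewrite eqxx.
Qed.

End BestApproximation.

(** * Perfectness *)

Lemma amax_perfect (K : fieldType) (O : K -> Prop) :
  valuation_ring O -> algebraically_maximal O -> DRvr O -> perfect K.
Proof.
move=> vO amO dr p pK x; have pr : prime p := pcharf_prime pK.
have p0 : p%:R = 0 :> K by case/andP: pK => _ /eqP.
have p_gt0 := prime_gt0 pr.
have [|Kh [ih [Oh [[vh eh dense _] surj]]]] := dr p.
  by split=> //; rewrite p0; apply: vmax0.
have p0h : p%:R = 0 :> Kh by rewrite -(rmorph_nat ih) p0 rmorph0.
have roots (b : Kh) : exists h, b = h ^+ p.
  have h1 (c : Kh) : Oh c -> exists h, c = h ^+ p.
    by move=> /surj[y [z [_ _]]]; rewrite p0h mul0r => /eqP; rewrite subr_eq0 => /eqP; exists y.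
  have [->|b0] := eqVneq b 0; first by exists 0; rewrite expr0n eqn0Ngt p_gt0.
  case: (vringV vh b0) => /h1 // [h e]; exists h^-1.
  by rewrite exprVn -e invrK.
(* Density replaces the p-th root in the completion by an element of K with the same leading
   term. *)
have approx (b : K) : b != 0 -> exists2 a, a != 0 & unit1 O (b / a ^+ p).
  move=> b0; have [h eh'] := roots (ih b).
  have h0 : h != 0.
    by move: b0; rewrite -(fmorph_eq0 ih) eh'; apply: contraNneq => ->; rewrite expr0n eqn0Ngt p_gt0.
  have [a ha] := dense h h h0.
  have u : unit1 Oh (ih a / h).
    by rewrite /unit1 -[_ - 1]opprB; apply: vmaxN => //; rewrite -(mulfV h0) -mulrBl.
  exists a.
    by apply: contraTneq (unit1_neq0 vh u) => ->; rewrite rmorph0 mul0r eqxx.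
  rewrite -(extends_unit1 eh) fmorph_div rmorphXn /= eh' -expr_div_n.
  by apply: unit1X => //; apply: unit1_div_sym.
pose f : {poly K} := 'X^p - x%:P.
have szf : size f = p.+1 by rewrite size_XnsubC.
have f0 : f != 0 by rewrite -size_poly_gt0 szf.
have [|M [j [_ [z rz]]]] := @fieldExt_root K K^o f; first by rewrite szf.
have [OM [vM eM]] := valuation_extends (j : {rmorphism K -> M}) vO.
have pM : p \in [pchar M] by rewrite (fmorph_pchar j).
have [|a ea] := amax_simple vO amO vM eM f0 rz.
  move=> g g0.
  (* Frobenius maps K(z) into K since z^p = x. So g(z)^p has the leading term of some a^p, and
     injectivity of Frobenius on residues compares g(z) with a. *)
  have [b eb] : exists b, (map_poly j g).[z] ^+ p = j b.
    elim/poly_ind: g {g0} => [|g c [b IH]].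
      by exists 0; rewrite !rmorph0 horner0 expr0n eqn0Ngt p_gt0.
    exists (b * x + c ^+ p); rewrite rmorphD rmorphM /= map_polyX map_polyC !hornerE.
    have /eqP := rootP rz; rewrite rmorphB rmorphXn /= map_polyX map_polyC !hornerE subr_eq0 => /eqP ez.
    by rewrite -!(pFrobenius_autE pM) rmorphD rmorphM /= !pFrobenius_autE IH ez
      rmorphD rmorphM rmorphXn.
  have b0 : b != 0 by rewrite -(fmorph_eq0 j) -eb expf_eq0 negb_and g0 orbT.
  have [a a0 u] := approx b b0; exists a => //.
  apply: (@unit1_root _ _ vM p 1) => //.
    by case/andP: pM => _ /eqP ->; apply: vmax0.
  rewrite expn1 expr_div_n eb -rmorphXn -fmorph_div (extends_unit1 eM) //.
exists a; apply: (fmorph_inj j).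
have /eqP := rootP rz; rewrite rmorphB rmorphXn /= map_polyX map_polyC !hornerE subr_eq0 => /eqP <-.
by rewrite ea rmorphXn.
Qed.

(** * Normal closures of extensions of a perfect field *)

(** A field in which the minimal polynomials of a basis split may be too large, so N is the subfield
    V generated over K by the roots. It contains the image of L because the basis elements are among
    the roots. *)
Lemma ex_normal_closure (K : fieldType) (L : fieldExtType K) :
  exists (N : splittingFieldType K) (j : {rmorphism L -> N}), forall a : K, j a%:A = a%:A.
Proof.
pose f : {poly L} := \prod_(b <- vbasis {:L}) minPoly 1 b.
have f0 : f != 0.
  by rewrite prodf_seq_neq0; apply/allP => b _; rewrite /= monic_neq0 ?monic_minPoly.
have f1 : f \is a polyOver 1%VS by apply: rpred_prod => b _; apply: minPolyOver.
have [M [j [jA [rs hrs]]]] := fieldExt_split f0.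
have jZ (k : K) x : j (k *: x) = k *: j x.
  by rewrite -[x in LHS]mul1r scalerAl rmorphM jA -scalerAl mul1r.
pose V := <<1 & rs>>%AS; pose N := subvs_of V.
have jV x : j x \in V.
  rewrite (coord_vbasis (memvf x)) rmorph_sum; apply: memv_suml => i _.
  rewrite jZ memvZ //; apply: seqv_sub_adjoin; rewrite -root_prod_XsubC.
  have /eqp_root <- := hrs; rewrite fmorph_root /f.
  have bi : (vbasis {:L})`_i \in vbasis {:L} by rewrite mem_nth // size_tuple.
  by rewrite (big_rem _ bi) /= rootM root_minPoly.
pose h x : N := vsproj V (j x).
have hK x : vsval (h x) = j x by rewrite vsprojK.
have hz : zmod_morphism h by move=> x y; rewrite /h rmorphB linearB.
have hm : monoid_morphism h.
  split=> [|x y]; apply: val_inj.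
    by rewrite [\val (h 1)]hK rmorph1 /= algid1.
  by rewrite [\val (h _)]hK rmorphM /= !hK.
pose hZ := GRing.isZmodMorphism.Build L N h hz.
pose hM := GRing.isMonoidMorphism.Build L N h hm.
pose hR : {rmorphism L -> N} := HB.pack h hZ hM.
have hA a : h a%:A = a%:A by apply: val_inj; rewrite [\val (h _)]hK jA /= algid1.
have ax : SplittingField.axiom N.
  exists (map_poly hR f).
    have /polyOver1P[q ->] := f1; apply/polyOver1P; exists q.
    by rewrite -map_poly_comp; apply: eq_map_poly => a /=; rewrite hA.
  pose toM := linfun (vsval : N -> M).
  have [zs Dzs] : exists zs, map toM zs = rs.
    exists (map (vsproj V) rs); rewrite -map_comp map_id_in // => y ys_y.
    by rewrite /= lfunE /= vsprojK ?seqv_sub_adjoin.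
  exists zs.
    rewrite -(eqp_map toM) -map_poly_comp (eq_map_poly (g := j)); last first.
      by move=> x /=; rewrite lfunE /= hK.
    rewrite (eqp_ltrans hrs) -Dzs big_map rmorph_prod.
    by under [X in _ %= X]eq_bigr do rewrite /= map_polyXsubC; apply: eqpxx.
  apply/vspaceP=> u; rewrite memvf.
  have : vsval u \in (toM @: <<1 & zs>>)%VS by rewrite aimg_adjoin_seq aimg1 Dzs (valP u).
  by case/memv_imgP=> v hv; rewrite lfunE => /val_inj->.
pose NS : splittingFieldType K := HB.pack N (FieldExt_isSplittingField.Build K N ax).
by exists NS, hR.
Qed.

(** An inseparable minimal polynomial is g(X^p). Taking p-th roots of the coefficients of g gives h
    over K with h(x)^p = g(x^p) = 0, a relation of too small a degree. *)
Lemma perfect_separable (K : fieldType) (N : fieldExtType K) :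
  perfect K -> forall x : N, separable_element 1 x.
Proof.
move=> pK x; apply: contrapT => /negP /(separablePn_pchar (K := 1%AS)) [p pN [g g1 eg]].
have pKp : p \in [pchar K] by rewrite -(fmorph_pchar (in_alg N)).
have pr := pcharf_prime pKp.
have [q eq] := polyOver1P g1.
have rt (a : K) : exists b : K, b ^+ p == a by have [b hb] := pK p pKp a; exists b; apply/eqP.
pose h := \poly_(i < size q) xchoose (rt q`_i).
have hx : root (map_poly (in_alg N) h) x.
  have := root_minPoly 1%AS x; rewrite eg root_comp hornerXn => /rootP; rewrite eq.
  rewrite (horner_coef) => e; apply/rootP/eqP.
  suff : (map_poly (in_alg N) h).[x] ^+ p == 0 by rewrite expf_eq0 => /andP[].
  rewrite (@horner_coef_wide _ (size q)); last by rewrite size_map_poly size_poly.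
  rewrite -(pFrobenius_autE pN) rmorph_sum /= -[X in _ == X]e size_map_poly; apply/eqP.
  apply: eq_bigr => i _; rewrite pFrobenius_autE exprMn !coef_map coef_poly ltn_ord /=.
  rewrite -(rmorphXn (in_alg N)) /= (eqP (xchooseP (rt q`_i))).
  by rewrite -!exprM mulnC.
have g0 : g != 0.
  by apply: contraTneq (monic_neq0 (monic_minPoly 1%AS x)) => e; rewrite eg e comp_poly0 eqxx.
have szm : (1 < size (minPoly 1%AS x))%N by rewrite size_minPoly ltnS.
have h0 : h != 0.
  apply: contraNneq g0 => e; rewrite eq map_poly_eq0; apply/eqP/polyP => i; rewrite coef0.
  have [lt|ge] := ltnP i (size q); last by rewrite nth_default.
  have := xchooseP (rt q`_i); move/polyP/(_ i): e; rewrite coef_poly lt coef0 => ->.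
  by rewrite expr0n eqn0Ngt prime_gt0 // => /eqP.
have h0' : map_poly (in_alg N) h != 0 by rewrite map_poly_eq0.
have le := dvdp_leq h0' (minPoly_dvdp (alg_polyOver _ h) hx).
have szh : (size (map_poly (in_alg N) h) <= size g)%N.
  by rewrite eq !size_map_poly size_poly.
have := size_comp_poly g 'X^p; rewrite -eg size_polyXn /=.
move: szm (le 1%AS) szh (prime_gt1 pr) => /=.
by move: (size (minPoly _ _)) (size g) (size (map_poly _ _)) => a b c; nia.
Qed.

Lemma perfect_galois (K : fieldType) (N : splittingFieldType K) :
  perfect K -> galois 1%AS {:N}.
Proof.
move=> pK; rewrite /galois sub1v normalFieldf andbT /=.
by apply/separableP => x _; apply: perfect_separable.
Qed.

(** * Henselianity *)

(** If v x were negative, the term x^n would have smaller value than all the others and could not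
    cancel. *)
Lemma vring_integral (L : fieldType) (O : L -> Prop) (f : {poly L}) x :
  valuation_ring O -> f \is monic -> (forall i, O f`_i) -> root f x -> O x.
Proof.
move=> vO mf Of /rootP rf; case: (vltVle O x 1) => [lt|/vle_vring //].
have x0 := vlt_neq0 vO lt.
have f_gt0 : (0 < size f)%N by rewrite size_poly_gt0 monic_neq0.
move: rf; rewrite horner_coef -(prednK f_gt0) big_ord_recr /=.
have -> : f`_(size f).-1 = 1 by move/monicP: mf.
move: (size f).-1 => n; rewrite mul1r => /eqP; rewrite addrC addr_eq0 => /eqP e.
have mx : vlt O 1 x^-1 by rewrite -invr1; apply: vltV => //; apply: oner_neq0.
case: (@vlt_irr _ _ vO (x ^+ n)); rewrite [X in vlt _ _ X]e; apply: vltN => //.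
apply: vlt_sum => //; first exact: expf_neq0.
move=> i _; rewrite -[x ^+ n]mul1r.
have -> : f`_i * x ^+ i = f`_i * x^-1 ^+ (n - i) * x ^+ n.
  by rewrite -mulrA [_ * x ^+ n]mulrC (exprBV x0 (leq_subr _ _)) subKn // ltnW.
apply: vltMr => //; first exact: expf_neq0.
rewrite -[1]mul1r; apply: vle_ltM => //; [exact: oner_neq0 | exact: vring_vle |].
apply/vmaxE => //; have : (0 < n - i)%N by rewrite subn_gt0.
case: (n - i)%N => // k _; rewrite exprSr; apply: vmaxMl => //; last exact/vmaxE.
apply: vringX => //; exact: (vle_vring (vlt_le vO mx)).
Qed.

Section Henselian.

Variables (K : fieldType) (O : K -> Prop).
Hypotheses (vO : valuation_ring O) (amO : algebraically_maximal O).
Variables (N : splittingFieldType K) (O1 : N -> Prop).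
Hypotheses (galN : galois 1%AS {:N}).
Hypotheses (v1 : valuation_ring O1) (e1 : extends (in_alg N) O O1).
Local Notation G := 'Gal({:N} / 1%AS)%g.

Lemma memv1P (x : N) : reflect (exists a, x = a%:A) (x \in 1%VS).
Proof. exact: (iffP (vlineP _ _)). Qed.

Lemma gal_base g a : g \in G -> (g : gal_of {:N}) a%:A = a%:A.
Proof. by move=> gG; apply: (fixed_gal (sub1v _) gG); apply/memv1P; exists a. Qed.

Lemma base_approx (b : N) : exists y0, forall y : K, vle O1 (b - y%:A) (b - y0%:A).
Proof.
have [q eq] := polyOver1P (minPolyOver 1%AS b).
apply: (@ex_best_approx K O vO amO N (in_alg N) O1 q) => //.
  by rewrite -(map_poly_eq0 (in_alg N)) -eq monic_neq0 ?monic_minPoly.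
by rewrite -eq root_minPoly.
Qed.

(** The sum of the distinct conjugates, read off the minimal polynomial, lies in K, and b is its
    only term of least value. *)
Lemma isolated_trace b : b != 0 ->
  (forall g, g \in G -> g b != b -> vlt O1 b (g b)) -> exists s : K, vlt O1 b (b - s%:A).
Proof.
move=> b0 iso.
have [r [/subsetP rG ur em]] := elimT (galois_factors (sub1v _)) galN b (memvf b).
have bin : b \in [seq (x : gal_of {:N}) b | x <- r].
  by rewrite -root_prod_XsubC -em root_minPoly.
have sz : size [seq (x : gal_of {:N}) b | x <- r] != 0%N.
  by rewrite -lt0n -has_predT; apply/hasP; exists b.
have := coefPn_prod_XsubC sz; rewrite -em => es.
have : (minPoly 1 b)`_(size [seq (x : gal_of {:N}) b | x <- r]).-1 \in 1%VS.
  exact: (polyOverP (minPolyOver 1%AS b)).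
rewrite es => /memv1P[a ea]; exists (- a).
rewrite scaleNr opprK -ea (big_rem _ bin) /= opprD addNKr.
apply: vltN => //; rewrite big_seq; apply: vlt_sum => // c.
rewrite mem_rem_uniq // inE => /andP[cb /mapP[g gr ec]].
by rewrite ec in cb *; apply: iso => //; apply: rG.
Qed.

Lemma isolated_base b :
  (forall g, g \in G -> g b != b -> vlt O1 b (g b)) -> exists a : K, b = a%:A.
Proof.
move=> iso; have [->|b0] := eqVneq b 0; first by exists 0; rewrite scale0r.
have [s hs] := isolated_trace b0 iso.
have [y hy] := base_approx b.
have [//|nb] := pselect (exists a : K, b = a%:A).
have by0 : b - y%:A != 0 by rewrite subr_eq0; apply/eqP => e; apply: nb; exists y.
have lt_by : vlt O1 b (b - y%:A) by apply: vlt_le_trans (hy s).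
have [ylb ygb] := vlt_subl v1 lt_by.
(* Here v y = v b and the other conjugates have larger value, so v (g b - y) = v b, which is below v
   (b - y). *)
have lt_g g : g \in G -> g b != b -> vlt O1 (g b - y%:A) (b - y%:A).
  move=> gG gb; apply: vle_lt_trans (lt_by) => //; apply: vle_trans (ygb) => //.
  have lt : vlt O1 y%:A (y%:A - (y%:A - g b)).
    by rewrite opprB addrC subrK; apply: (vle_lt_trans v1 ygb (iso g gG gb)).
  have [_ h] := vlt_subl v1 lt.
  by rewrite -[g b - _]opprB; apply: vleNl.
have gby g : g \in G -> g (b - y%:A) = g b - y%:A by move=> gG; rewrite rmorphB /= gal_base.
(* Thus (b - y)^-1 is itself isolated and has an approximation t in K; then y + 1/t is closer to b
   than the best approximation y. *)
have [|t ht] := @isolated_trace (b - y%:A)^-1 (invr_neq0 by0).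
  move=> g gG; rewrite fmorphV /= gby // => ne; apply: vltV => //; apply: lt_g => //.
  by apply: contraNneq ne => ->.
have [/(vle_trans v1) _ th] := vlt_subl v1 ht.
have t0 : t%:A != 0 :> N.
  apply/eqP => e; move: th; rewrite e => /vle0l /eqP; rewrite invr_eq0; exact/negP.
case: (@vlt_irr _ _ v1 (b - y%:A)).
apply: vlt_le_trans (hy (y + t^-1)) => //.
have -> : b - (y + t^-1)%:A = ((b - y%:A)^-1 - t%:A) * - ((b - y%:A) * t%:A^-1).
  rewrite scalerDl (_ : t^-1%:A = t%:A^-1); last exact: (fmorphV (in_alg N)).
  rewrite mulrN mulrBl mulKf // mulrCA mulfV // mulr1 opprB opprD addrA.
  by [].
rewrite -[X in vlt _ X](mulKf (invr_neq0 by0)) invrK.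
rewrite mulrN; apply: vltN => //.
have -> : (b - y%:A) * ((b - y%:A)^-1 * (b - y%:A)) = (b - y%:A)^-1 * ((b - y%:A) * (b - y%:A)).
  by rewrite mulrCA.
apply: vlt_leM => //; first exact: mulf_neq0.
apply: vleMl => //; rewrite -[X in vle _ X]invrK.
exact: vleV (invr_neq0 by0) th.
Qed.

(* If [v (g x)] were not constant, the product of the conjugates of minimal value would be
   isolated from its other conjugates. *)
Lemma gal_vle g x : g \in G -> vle O1 x (g x).
Proof.
move=> gG; have [->|x0] := eqVneq x 0; first by rewrite rmorph0; apply: vle_refl.
have gx0 (h : gal_of {:N}) : h x != 0 by rewrite fmorph_eq0.
have [m mG mmin] := @ex_vmin _ _ v1 _ (enum G) (fun h : gal_of {:N} => h x) 1%g
  (etrans (mem_enum _ _) (group1 _)).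
rewrite mem_enum in mG.
have {}mmin h : h \in G -> vle O1 (m x) (h x) by move=> hG; apply: mmin; rewrite mem_enum.
pose S := [set h in G | `[< vle O1 (h x) (m x) >]].
(* Dividing each factor by m x turns c into a unit times a power of m x, which makes its value
   explicit. *)
pose b := \prod_(h in S) (h x / m x).
have ub : vunit O1 b.
  rewrite /b; apply: (big_ind (vunit O1)); [exact: vunit1 | exact: vunitM |].
  move=> h; rewrite inE => /andP[hG /asboolP le]; split; first by rewrite mulf_neq0 ?invr_neq0.
    by apply/vle_divE => //; apply: mmin.
  by rewrite invf_div; apply/vle_divE.
pose c := \prod_(h in S) h x.
have ec : c = b * m x ^+ #|S| by rewrite /b prodf_div prodr_const divfK // expf_neq0.
have hc h : h \in G -> h c = \prod_(k in (S :* h)%g) k x.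
  move=> hG; rewrite rmorph_prod [RHS](reindex_inj (mulIg h)) /=.
  apply: eq_big => [k|k _]; first by rewrite mem_rcoset mulgK.
  by rewrite galM ?memvf.
have lt_hc h : h \in G -> (S :* h)%g != S -> vlt O1 c (h c).
  move=> hG neS.
  (* A translate of S has the size of S, so if it differs it has a member outside S, whose factor
     has value above the minimum. *)
  have [k kSh kS] : exists2 k, k \in (S :* h)%g & k \notin S.
    apply/subsetPn; apply: contraNN neS => sub.
    by rewrite eqEcard sub /= card_rcoset.
  have ehc : h c = (\prod_(k in (S :* h)%g) (k x / m x)) * m x ^+ #|S|.
    by rewrite hc // prodf_div prodr_const card_rcoset divfK // expf_neq0.
  rewrite ehc ec; apply: vltMr => //; first exact: expf_neq0.
  have ShG l : l \in (S :* h)%g -> l \in G.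
    rewrite mem_rcoset inE => /andP[lG _]; by rewrite -(groupMr _ (groupVr hG)).
  have lt : vlt O1 1 (\prod_(k in (S :* h)%g) (k x / m x)).
    apply/vmaxE => //; rewrite (bigD1 k) //=; apply: vmaxMr => //.
      apply/vmax_divE => // le; move/negP: kS; apply; rewrite inE ShG //; exact/asboolP.
    apply: vring_prod => // l /andP[/ShG lG _]; apply/vle_divE => //; exact: mmin.
  by apply: vle_lt_trans lt => //; have /vunitE[] := ub.
have iso h : h \in G -> h c != c -> vlt O1 c (h c).
  by move=> hG ne; apply: lt_hc => //; apply: contraNneq ne => e; rewrite hc // e.
have [a ea] := isolated_base iso.
(* As c lies in K, no h sends it to a larger value. If some h in G were outside S, the translate of
   S by m^-1 h would contain h and so differ from S. *)
have SG : S = G.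
  apply/eqP; rewrite eqEsubset; apply/andP; split; apply/subsetP => h.
    by rewrite inE => /andP[].
  move=> hG; apply: contrapT => /negP hS.
  have mS : m \in S by rewrite inE mG; apply/asboolP; apply: vle_refl.
  have lG : (m^-1 * h)%g \in G by rewrite groupM ?groupV.
  have hSl : h \in (S :* (m^-1 * h))%g by rewrite mem_rcoset invMg invgK mulKVg.
  case: (@vlt_irr _ _ v1 c); rewrite [X in vlt _ _ X](_ : c = (m^-1 * h)%g c).
    by apply: lt_hc => //; apply: contraNneq hS => <-.
  by rewrite ea gal_base.
have : g \in S by rewrite SG.
rewrite inE => /andP[_ /asboolP le].
have : 1%g \in S by rewrite SG group1.
rewrite inE => /andP[_ /asboolP]; rewrite gal_id => le1.
by apply: vle_trans le1 _ => //; apply: mmin.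
Qed.

Lemma conj_vle (x y : N) : root (minPoly 1 x) y -> vle O1 x y.
Proof.
have [r [/subsetP rG _ ->]] := elimT (galois_factors (sub1v _)) galN x (memvf x).
by rewrite root_prod_XsubC => /mapP[g /rG gG ->]; apply: gal_vle.
Qed.

Lemma vring_minPoly (x : N) : O1 x -> forall i, O1 (minPoly 1 x)`_i.
Proof.
move=> Ox.
have [r [/subsetP rG _ ->]] := elimT (galois_factors (sub1v _)) galN x (memvf x).
have : {in [seq (g : gal_of {:N}) x | g <- r], forall b, O1 b}.
  move=> _ /mapP[g /rG gG ->]; apply: vle_vring.
  by apply: vle_trans (gal_vle _ gG) => //; apply: vring_vle.
elim: [seq _ | _ <- r] => [_ i|b s IH h i].
  by rewrite big_nil coef1; case: (i == _); [exact: vring1 | exact: vring0].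
have Ob : O1 b by apply: h; rewrite mem_head.
have {}IH j : O1 (\prod_(c <- s) ('X - c%:P))`_j.
  by apply: IH => c cs; apply: h; rewrite inE cs orbT.
rewrite big_cons mulrBl coefB coefXM coefCM.
apply: vringB => //; last exact: vringM.
by case: (i == 0%N) => //; apply: vring0.
Qed.

End Henselian.

(** L may be infinite over K, so y is moved to the normal closure of K(y), with a valuation
    extending the one induced by [OL]. There the conjugates of y have its value, which makes the
    minimal polynomial integral. *)
Lemma amax_integral (K : fieldType) (O : K -> Prop) (L : fieldType)
    (iota : {rmorphism K -> L}) OL y :
  valuation_ring O -> algebraically_maximal O -> perfect K ->
  algebraic iota -> valuation_ring OL -> extends iota O OL -> OL y ->
  exists f : {poly K}, [/\ f \is monic, forall i, O f`_i & root (map_poly iota f) y].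
Proof.
move=> vO amO pK alg vL eL Oy.
have exn : exists n, `[< exists f : {poly K},
    [/\ f != 0, root (map_poly iota f) y & size f = n] >].
  by have [f [f0 rf]] := alg y; exists (size f); apply/asboolP; exists f.
case: (ex_minnP exn) => n /asboolP[f [f0 rf sz]] mn.
have irr : irreducible_poly f.
  apply/(subfx_irreducibleP rf f0) => q rq q0; rewrite sz; apply: mn; apply/asboolP.
  by exists q.
pose L0 := SubFieldExtType rf irr.
pose j0 : {rmorphism L0 -> L} := subfx_inj.
have j0A a : j0 a%:A = iota a by apply: subfx_inj_base.
pose z : L0 := subfx_root iota y f.
have j0z : j0 z = y by apply: subfx_inj_root.
pose O0 x := OL (j0 x).
have v0 : valuation_ring O0.
  split; rewrite /O0; first by rewrite rmorph1; apply: vring1.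
  - by move=> u w; rewrite rmorphB; apply: vringB.
  - by move=> u w; rewrite rmorphM; apply: vringM.
  - by move=> u u0; rewrite fmorphV; apply: vringV => //; rewrite fmorph_eq0.
have [N [j jA]] := ex_normal_closure L0.
have [O1 [v1 e1]] := valuation_extends j v0.
have eN : extends (in_alg N) O O1.
  move=> a; have -> : in_alg N a = j a%:A by rewrite jA.
  by rewrite (extendsE e1) /O0 j0A.
have galN := perfect_galois N pK.
have [q eq] := polyOver1P (minPolyOver 1%AS (j z)).
exists q; split.
- by have := monic_minPoly 1%AS (j z); rewrite eq map_monic.
- move=> i; rewrite -(extendsE eN) -coef_map -eq.
  by apply: (vring_minPoly vO amO galN v1 eN); rewrite (extendsE e1) /O0 j0z.
have := root_minPoly 1%AS (j z); rewrite eq.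
rewrite (eq_map_poly (g := j \o in_alg L0)); last by move=> a /=; rewrite jA.
rewrite map_poly_comp fmorph_root -(fmorph_root j0) -map_poly_comp j0z.
by rewrite (eq_map_poly (g := iota)) // => a /=; rewrite j0A.
Qed.

(** Elements of one extension of O are integral over O, and integral elements lie in every
    extension: this is uniqueness. *)
Lemma amax_henselian (K : fieldType) (O : K -> Prop) :
  valuation_ring O -> algebraically_maximal O -> perfect K -> henselian O.
Proof.
move=> vO amO pK L iota alg; have [OL [vL eL]] := valuation_extends iota vO.
have sub OL1 OL2 y : valuation_ring OL1 -> extends iota O OL1 ->
    valuation_ring OL2 -> extends iota O OL2 -> OL1 y -> OL2 y.
  move=> v1 e1 v2 e2 Oy.
  have [f [mf Of rf]] := amax_integral vO amO pK alg v1 e1 Oy.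
  apply: vring_integral rf => //; first by rewrite map_monic.
  by move=> i; rewrite coef_map (extendsE e2).
by exists OL; split=> // OL' vL' eL' y; split; apply: sub.
Qed.

(** * Valuation independent and valuation generating families *)

Lemma ex_kernel_vector (K : fieldType) (I J : finType) (A : I -> J -> K) :
  (#|J| < #|I|)%N ->
  exists c : I -> K, (exists i, c i != 0) /\ forall j, \sum_i c i * A i j = 0.
Proof.
move=> lt; pose M := \matrix_(i < #|I|, j < #|J|) A (enum_val i) (enum_val j).
have : kermx M != 0.
  rewrite kermx_eq0 /row_free neq_ltn (leq_ltn_trans _ lt) //.
  exact: rank_leq_col.
case/matrix0Pn=> r [s nz]; exists (fun i => kermx M r (enum_rank i)); split.
  by exists (enum_val s); rewrite enum_valK.
move=> j; have /matrixP/(_ r (enum_rank j)) := mulmx_ker M.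
rewrite [LHS]mxE [RHS]mxE (reindex _ (onW_bij _ (enum_rank_bij I))) /= => e; rewrite -[RHS]e.
by apply: eq_bigr => i _; rewrite [M _ _]mxE !enum_rankK.
Qed.

(** With the ultrametric inequality, the value of a sum is exactly the minimum over its terms. The
    coefficient set A varies: it will be K, an intermediate field, or the elements with value in
    vK. *)
Definition vorth (L : fieldType) (OL A : L -> Prop) (I : finType) (z : I -> L) : Prop :=
  (forall i, z i != 0) /\
  forall a : I -> L, (forall i, A (a i)) -> forall i, vle OL (\sum_j a j * z j) (a i * z i).

(** Only the leading term of x has to be reached, by terms none of which has value below v x. This
    does not entail linear spanning, and the difference is the defect. *)
Definition vspan (L : fieldType) (OL A : L -> Prop) (I : finType) (z : I -> L) : Prop :=
  forall x, x != 0 -> exists a : I -> L,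
    [/\ forall i, A (a i), forall i, vle OL x (a i * z i) &
        vlt OL x (x - \sum_i a i * z i)].

Definition vbase (K L : fieldType) (iota : K -> L) (x : L) : Prop := exists a, x = iota a.

Section Families.

Variables (L : fieldType) (OL : L -> Prop).
Hypothesis vL : valuation_ring OL.

Lemma vle_sum_distinct (I : finType) (t : I -> L) :
  (forall i j, i != j -> t i != 0 -> t j != 0 -> vlt OL (t i) (t j) \/ vlt OL (t j) (t i)) ->
  forall i, vle OL (\sum_j t j) (t i).
Proof.
move=> dist i.
have [m _ hm] := @ex_vmin _ _ vL _ (enum I) t i (mem_enum _ i).
have {}hm j : vle OL (t m) (t j) by apply: hm; rewrite mem_enum.
apply: vle_trans (hm i) => //.
have [tm0|tm0] := eqVneq (t m) 0; first by rewrite tm0; apply: vle0.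
have lt : vlt OL (t m) (t m - \sum_j t j).
  rewrite (bigD1 m) //= opprD addNKr; apply: vltN => //; apply: vlt_sum => // j jm.
  have [->|tj0] := eqVneq (t j) 0; first exact: vlt0.
  by rewrite eq_sym in jm; case: (dist m j jm tm0 tj0) => // lt; case: (lt (hm j)).
by have [] := vlt_subl vL lt.
Qed.

(** Sums over the inner family become coefficients of the outer one, whence the two coefficient
    sets. *)
Lemma vorth_comp (A B : L -> Prop) (I J : finType) (z : I -> L) (w : J -> L) :
  (forall a : I -> L, (forall i, A (a i)) -> B (\sum_i a i * z i)) ->
  vorth OL A z -> vorth OL B w -> vorth OL A (fun ij : I * J => z ij.1 * w ij.2).
Proof.
move=> AB [z0 oz] [w0 ow]; split=> [[i j]|a hA [i j]] /=; first exact: mulf_neq0.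
pose b k := \sum_i a (i, k) * z i.
have -> : \sum_k a k * (z k.1 * w k.2) = \sum_k b k * w k.
  transitivity (\sum_l \sum_k a (l, k) * (z l * w k)).
    by rewrite pair_bigA; apply: eq_bigr => -[].
  rewrite exchange_big /=.
  by apply: eq_bigr => k _; rewrite mulr_suml; apply: eq_bigr => l _; rewrite mulrA.
apply: vle_trans (ow b _ j) _ => //; first by move=> k; apply: AB.
by rewrite mulrA; apply: vleMr => //; apply: oz (fun i => a (i, j)) _ i.
Qed.

Lemma vspan_comp (A B : L -> Prop) (I J : finType) (z : I -> L) (w : J -> L) :
  A 0 ->
  (forall x, B x -> x != 0 -> exists a : I -> L, [/\ forall i, A (a i),
     forall i, vle OL x (a i * z i) & vlt OL x (x - \sum_i a i * z i)]) ->
  vspan OL B w -> vspan OL A (fun ij : I * J => z ij.1 * w ij.2).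
Proof.
move=> A0 sz sw x x0; have [b [Bb bw lt]] := sw x x0.
have /choice[a ha] : forall j, exists a : I -> L, [/\ forall i, A (a i),
    forall i, vle OL (b j) (a i * z i) &
    b j != 0 -> vlt OL (b j) (b j - \sum_i a i * z i)].
  move=> j; have [bj0|bj0] := eqVneq (b j) 0.
    by exists (fun _ => 0); split=> // i; rewrite bj0 mul0r; apply: vle0.
  by have [a [h1 h2 h3]] := sz _ (Bb j) bj0; exists a.
exists (fun ij => a ij.2 ij.1); split=> [[i j]|[i j]|] /=; first by case: (ha j).
  rewrite mulrA; apply: vle_trans (bw j) _ => //; apply: vleMr => //.
  by case: (ha j).
have -> : \sum_k a k.2 k.1 * (z k.1 * w k.2) = \sum_j (\sum_i a j i * z i) * w j.
  transitivity (\sum_l \sum_k a k l * (z l * w k)).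
    by rewrite pair_bigA; apply: eq_bigr => -[].
  rewrite exchange_big /=.
  by apply: eq_bigr => k _; rewrite mulr_suml; apply: eq_bigr => l _; rewrite mulrA.
have -> : x - \sum_j (\sum_i a j i * z i) * w j =
    (x - \sum_j b j * w j) + \sum_j (b j - \sum_i a j i * z i) * w j.
  rewrite -[x in LHS](subrK (\sum_j b j * w j)) -addrA; congr (_ + _).
  by rewrite -sumrB; apply: eq_bigr => j _; rewrite mulrBl.
apply: vltD => //; apply: vlt_sum => // j _; have [_ h2 h3] := ha j.
have [wj0|wj0] := eqVneq (w j) 0; first by rewrite wj0 mulr0; apply: vlt0.
have [bj0|bj0] := eqVneq (b j) 0.
  rewrite bj0 sub0r big1 ?oppr0 ?mul0r; first exact: vlt0.
  by move=> i _; have := h2 i; rewrite bj0 => /vle0l.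
by apply: vle_lt_trans (bw j) _ => //; apply: vltMr => //; apply: h3.
Qed.

End Families.

Section BaseFamilies.

Variables (K L : fieldType) (iota : {rmorphism K -> L}) (OL : L -> Prop).
Hypothesis vL : valuation_ring OL.

(** If there were more w than z, a linear relation among the coefficients of their leading terms
    would combine the w to a sum of value above the minimum of its terms. *)
Lemma vorth_le_vspan (I J : finType) (w : I -> L) (z : J -> L) :
  vorth OL (vbase iota) w -> vspan OL (vbase iota) z -> (#|I| <= #|J|)%N.
Proof.
move=> [w0 ow] sz; rewrite leqNgt; apply/negP => lt.
have /choice[a ha] : forall i, exists a : J -> K,
    (forall j, vle OL (w i) (iota (a j) * z j)) /\
    vlt OL (w i) (w i - \sum_j iota (a j) * z j).
  move=> i; have [b [/choice[a ab] h2 h3]] := sz _ (w0 i).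
  exists a; split=> [j|]; first by rewrite -ab.
  by under eq_bigr do rewrite -ab.
have [c [[i0 ci0] hc]] := ex_kernel_vector a lt.
have [m _ hm] := @ex_vmin _ _ vL _ (enum I) (fun i => iota (c i) * w i) i0 (mem_enum _ i0).
have {}hm j : vle OL (iota (c m) * w m) (iota (c j) * w j) by apply: hm; rewrite mem_enum.
have cm0 : iota (c m) * w m != 0.
  apply: contra_not_neq (_ : iota (c i0) * w i0 <> 0) => [e|].
    by have := hm i0; rewrite e => /vle0l.
  by apply/eqP; rewrite mulf_neq0 ?fmorph_eq0.
suff lts : vlt OL (iota (c m) * w m) (\sum_i iota (c i) * w i).
  by apply: lts; apply: (ow (fun i => iota (c i))) => i; exists (c i).
suff -> : \sum_i iota (c i) * w i =
    \sum_i iota (c i) * (w i - \sum_j iota (a i j) * z j).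
  apply: vlt_sum => // i _; have [_ lti] := ha i.
  have [ci|ci] := eqVneq (c i) 0; first by rewrite ci rmorph0 mul0r; apply: vlt0.
  apply: vle_lt_trans (hm i) _ => //; apply: vltMl => //; by rewrite fmorph_eq0.
under [RHS]eq_bigr do rewrite mulrBr.
rewrite sumrB; apply/eqP; rewrite -subr_eq0 opprB addrC subrK; apply/eqP.
under eq_bigr do rewrite mulr_sumr.
rewrite exchange_big big1 //= => j _.
under eq_bigr do rewrite mulrA -rmorphM.
by rewrite -mulr_suml -rmorph_sum hc rmorph0 mul0r.
Qed.

End BaseFamilies.

(** * Ramification index, residue degree and the products realising them *)

Section RamificationResidue.

Variables (K L : fieldType) (iota : {rmorphism K -> L}) (O : K -> Prop) (OL : L -> Prop).
Hypotheses (vO : valuation_ring O) (vL : valuation_ring OL) (eL : extends iota O OL).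

(** Elements with value in vK, with 0 included through k = 0. Combinations over K of
    residue-independent elements stay in this set, so that they can be coefficients of a
    ramification family. *)
Let B (x : L) : Prop := exists k, vle OL x (iota k) /\ vle OL (iota k) x.

(** The nonzero terms lie in distinct cosets of vK, so their values are pairwise different. *)
Lemma ram_vorth (I : finType) (y : I -> L) : (forall i, y i != 0) ->
  (forall i j (a : K), a != 0 -> vunit OL (y i / (y j * iota a)) -> i = j) -> vorth OL B y.
Proof.
move=> y0 ny; split=> // a Ba; apply: vle_sum_distinct => // i j ij.
rewrite !mulf_eq0 !negb_or => /andP[ai0 _] /andP[aj0 _].
case: (vltVle OL (a i * y i) (a j * y j)) => [|le1]; first by left.
case: (vltVle OL (a j * y j) (a i * y i)) => [|le2]; first by right.
have [ki [ki1 ki2]] := Ba i; have [kj [kj1 kj2]] := Ba j.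
have nz x k : x != 0 -> vle OL (iota k) x -> k != 0.
  by move=> x0 h; apply: contraNneq x0 => k0; move: h; rewrite k0 rmorph0 => /vle0l->.
have ki0 := nz _ _ ai0 ki2; have kj0 := nz _ _ aj0 kj2.
case/eqP: ij; apply: (ny i j (kj / ki)); first by rewrite mulf_neq0 ?invr_neq0.
have ik0 : iota ki != 0 by rewrite fmorph_eq0.
have jk0 : iota kj != 0 by rewrite fmorph_eq0.
have -> : y i / (y j * iota (kj / ki)) = (iota ki * y i) / (iota kj * y j).
  by rewrite fmorph_div !invfM invrK; move: (y0 j); move: (y j) (y i) => u w u0; ring.
have d0 : iota kj * y j != 0 by rewrite mulf_neq0.
split; first by rewrite mulf_neq0 ?invr_neq0 ?mulf_neq0.
  apply/vle_divE => //; apply: vle_trans (vleMr vL (y i) ki1) => //.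
  by apply: vle_trans (vleMr vL (y j) kj2) _.
rewrite invf_div; apply/vle_divE; first by rewrite mulf_neq0.
apply: vle_trans (vleMr vL (y j) kj1) => //.
by apply: vle_trans (vleMr vL (y i) ki2) _.
Qed.

Lemma vorth_sub (A A' : L -> Prop) (I : finType) (z : I -> L) :
  (forall x, A x -> A' x) -> vorth OL A' z -> vorth OL A z.
Proof. by move=> sub [z0 oz]; split=> // a Aa; apply: oz => i; apply: sub. Qed.

Lemma vbaseB x : vbase iota x -> B x.
Proof. by case=> k ->; exists k; split; apply: vle_refl. Qed.

(** Indexing by [nat], cut off at n, makes it easy to extend a family of maximal length by one more
    element. *)
Definition res_indep (n : nat) (u : nat -> L) : Prop :=
  (forall i, (i < n)%N -> OL (u i)) /\
  forall c : nat -> K, (forall i, O (c i)) -> vmax OL (\sum_(i < n) iota (c i) * u i) ->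
    forall i, (i < n)%N -> vmax O (c i).

(** After division by a coefficient of least value the coefficients are integral and one of them is
    1, so by independence of the residues the sum is a unit. *)
Lemma res_indep_B n u (a : 'I_n -> L) : res_indep n u -> (forall i, vbase iota (a i)) ->
  exists k, [/\ vle OL (\sum_i a i * u i) (iota k), vle OL (iota k) (\sum_i a i * u i) &
    forall i, vle OL (iota k) (a i)].
Proof.
move=> [Ou ind] /choice[b ab].
have [m hm] : exists m : K, (forall i, vle O m (b i)) /\ ((exists i, m = b i) \/ m = 0).
  case: n a b ab ind Ou => [|n] a b ab ind Ou; first by exists 0; split=> [[]|] //; right.
  have [i _ hi] := @ex_vmin _ _ vO _ (enum 'I_n.+1) b ord0 (mem_enum _ _).
  by exists (b i); split=> [j|]; [apply: hi; rewrite mem_enum | left; exists i].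
have [h1 h2] := hm; exists m.
have [m0|m0] := eqVneq m 0.
  rewrite m0 rmorph0.
  have a0 i : a i = 0 by have := h1 i; rewrite m0 ab => /vle0l ->; rewrite rmorph0.
  by rewrite big1 => [|i _]; [split=> [||i]; rewrite ?a0; apply: vle_refl | rewrite a0 mul0r].
have {h2} [i0 ei0] : exists i, m = b i by case: h2 => // e; rewrite e eqxx in m0.
have im0 : iota m != 0 by rewrite fmorph_eq0.
have h1' i : vle OL (iota m) (a i) by rewrite ab (extends_vle vO eL).
pose c i := if insub i is Some j then b j / m else 0.
have ec (i : 'I_n) : c i = b i / m by rewrite /c valK.
have Oc i : O (c i).
  by rewrite /c; case: insubP => [j _ _|_]; [apply/vle_divE | apply: vring0].
pose s := \sum_(i < n) iota (c i) * u i.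
have es : \sum_i a i * u i = iota m * s.
  rewrite mulr_sumr; apply: eq_bigr => i _; rewrite ec ab fmorph_div mulrA.
  by rewrite [iota m * _]mulrC divfK.
have Os : OL s.
  by apply: vring_sum => // i _; apply: vringM => //; [rewrite (extendsE eL) | apply: Ou].
have us : vunit OL s.
  case: (vring_maxVunit Os) => // ms; have := ind c Oc ms i0 (ltn_ord i0).
  by rewrite ec -ei0 mulfV // => /(vmaxNV1 vO).
have /vunitE[s1 s2] := us; rewrite es; split=> //.
  by rewrite -[X in vle _ _ X]mulr1; apply: vleMl.
by rewrite -[X in vle _ X]mulr1; apply: vleMl.
Qed.

Lemma res_vorth n u : res_indep n u -> vorth OL (vbase iota) (fun i : 'I_n => u i).
Proof.
move=> iu; have [Ou ind] := iu; split=> [i|a Aa i].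
  apply/eqP => ui0; apply: (vmaxNV1 vO).
  have := ind (fun j => (j == i)%:R) _ _ i (ltn_ord i); rewrite eqxx; apply.
    by move=> j; apply: vring_nat.
  rewrite big1 => [|j _]; first exact: vmax0.
  by case: eqP => [e|_]; rewrite ?rmorph0 ?mul0r // e ui0 mulr0.
have [k [h1 h2 h3]] := res_indep_B iu Aa.
apply: vle_trans h1 _ => //; rewrite -[iota k]mulr1; apply: vleM => //.
by apply: vring_vle; apply: Ou.
Qed.

Definition ram_indep (n : nat) (y : nat -> L) : Prop :=
  (forall i, (i < n)%N -> y i != 0) /\
  forall i j (a : K), (i < n)%N -> (j < n)%N -> a != 0 ->
    vunit OL (y i / (y j * iota a)) -> i = j.

Lemma ram_indep_vorth n y : ram_indep n y -> vorth OL B (fun i : 'I_n => y i).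
Proof.
move=> [y0 ny]; apply: ram_vorth => [i|i j a a0 h]; first exact: y0.
by apply: val_inj; apply: ny h.
Qed.

Lemma vunit_div_sym x y (a : K) : a != 0 -> vunit OL (x / (y * iota a)) ->
  vunit OL (y / (x * iota a^-1)).
Proof.
by move=> a0 /vunitV; rewrite invf_div fmorphV invfM invrK mulrA mulrAC.
Qed.

Variable bound : nat.
Hypothesis vorth_bound :
  forall n (z : 'I_n -> L), vorth OL (vbase iota) z -> (n <= bound)%N.

Lemma ex_ram_index : exists e (y : 'I_e -> L), [/\ ram_index iota OL e, vorth OL B y &
  forall x, x != 0 -> exists i (a : K), a != 0 /\ vunit OL (x / (y i * iota a))].
Proof.
have ex0 : exists n, `[< exists y, ram_indep n y >].
  by exists 0%N; apply/asboolP; exists (fun _ => 0).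
have bd n : `[< exists y, ram_indep n y >] -> (n <= bound)%N.
  move=> /asboolP[y /ram_indep_vorth oy]; apply: vorth_bound.
  exact: vorth_sub vbaseB oy.
case: (ex_maxnP ex0 bd) => e /asboolP[y iy] mx; have [y0 ny] := iy.
have cover x : x != 0 -> exists (i : 'I_e) (a : K), a != 0 /\ vunit OL (x / (y i * iota a)).
  move=> x0; apply: contrapT => nx.
  suff : (e < e)%N by rewrite ltnn.
  apply: mx; apply/asboolP; exists (fun i => if (i < e)%N then y i else x); split.
    by move=> i _; case: ifP => // /y0.
  move=> i j a; rewrite !ltnS => ie je a0.
  case: ifPn => [ilt|ige]; case: ifPn => [jlt|jge] h.
  - exact: ny h.
  - case: nx; exists (Ordinal ilt), a^-1; split; first exact: invr_neq0.
    exact: vunit_div_sym.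
  - by case: nx; exists (Ordinal jlt), a.
  by apply/eqP; rewrite eqn_leq; lia.
exists e, (fun i : 'I_e => y i); split=> //; last exact: ram_indep_vorth.
exists (fun i : 'I_e => y i); split=> // [i|i j a a0 h]; first exact: y0.
by apply: val_inj; apply: ny h.
Qed.

Lemma ex_res_degree : exists f (u : 'I_f -> L), [/\ res_degree iota O OL f,
  vorth OL (vbase iota) u, (forall i, OL (u i)),
  (forall a : 'I_f -> L, (forall i, vbase iota (a i)) -> B (\sum_i a i * u i)) &
  forall x, OL x -> exists c : 'I_f -> K,
    (forall i, O (c i)) /\ vmax OL (x - \sum_i iota (c i) * u i)].
Proof.
have ex0 : exists n, `[< exists u, res_indep n u >].
  by exists 0%N; apply/asboolP; exists (fun _ => 0).
have bd n : `[< exists u, res_indep n u >] -> (n <= bound)%N.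
  by move=> /asboolP[u /res_vorth ou]; apply: vorth_bound ou.
case: (ex_maxnP ex0 bd) => f /asboolP[u iu] mx; have [Ou ind] := iu.
have cover x : OL x -> exists c : 'I_f -> K,
    (forall i, O (c i)) /\ vmax OL (x - \sum_i iota (c i) * u i).
  move=> Ox; apply: contrapT => nx.
  suff : (f < f)%N by rewrite ltnn.
  apply: mx; apply/asboolP; exists (fun i => if (i < f)%N then u i else x); split.
    by move=> i _; case: ifP => // /Ou.
  move=> c Oc; rewrite big_ord_recr /= ltnn.
  under eq_bigr do rewrite ltn_ord.
  move=> mc; have mcf : vmax O (c f).
    case: (vring_maxVunit (Oc f)) => // uf; case: nx.
    have [cf0 _ Oci] := uf.
    exists (fun i : 'I_f => - (c i / c f)); split.
      by move=> i; apply: vringN => //; apply: vringM.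
    have -> : x - \sum_(i < f) iota (- (c i / c f)) * u i =
        iota (c f)^-1 * (\sum_(i < f) iota (c i) * u i + iota (c f) * x).
      rewrite mulrDr mulrA -rmorphM mulVf // rmorph1 mul1r addrC; congr (_ + _).
      rewrite mulr_sumr -sumrN; apply: eq_bigr => i _.
      by rewrite rmorphN mulNr opprK rmorphM mulrCA mulrA.
    by apply: vmaxMl => //; rewrite (extendsE eL).
  move=> i; rewrite ltnS leq_eqVlt => /orP[/eqP->//|].
  apply: (ind c Oc _ i); rewrite -[\sum_(i < f) _](addrK (iota (c f) * x)).
  by apply: vmaxB => //; apply: vmaxMr => //; rewrite (extends_vmax eL).
exists f, (fun i : 'I_f => u i); split=> //; first 1 last.
- exact: res_vorth.
- by move=> i; apply: Ou.
- by move=> a Aa; have [k [h1 h2 _]] := res_indep_B iu Aa; exists k.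
- exists (fun i : 'I_f => u i); split=> // [i|c Oc mc i]; first exact: Ou.
  pose c' i := if insub i is Some j then c j else 0.
  have ec (j : 'I_f) : c' j = c j by rewrite /c' valK.
  rewrite -ec; apply: (ind c') => //.
    by move=> j; rewrite /c'; case: insubP => // _; apply: vring0.
  by under eq_bigr do rewrite ec.
Qed.

(** These are the e f products from the proof of the fundamental inequality. They capture all
    leading terms of L, defect or not. *)
Lemma ex_ramification_residue :
  exists e f (z : 'I_f * 'I_e -> L), [/\ ram_index iota OL e, res_degree iota O OL f,
    vorth OL (vbase iota) z & vspan OL (vbase iota) z].
Proof.
have [e [y [re oy cy]]] := ex_ram_index.
have [f [u [rf ou Ou Bu cu]]] := ex_res_degree.
exists e, f, (fun ij => u ij.1 * y ij.2); split=> //; first exact: vorth_comp Bu ou oy.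
apply: (@vspan_comp _ _ vL _ B) => //; first by exists 0; rewrite rmorph0.
- move=> x [k [k1 k2]] x0.
  have k0 : iota k != 0.
    by apply: contraNneq x0 => k0; move: k2; rewrite k0 => /vle0l->.
  have Ow : OL (x / iota k) by apply/vle_divE.
  have [c [Oc mc]] := cu _ Ow.
  exists (fun i => iota (k * c i)); split=> [i|i|].
  + by exists (k * c i).
  + apply: vle_trans k1 _ => //; rewrite rmorphM -mulrA -[X in vle _ X]mulr1.
    apply: vleMl => //; apply: vring_vle; apply: vringM => //; first by rewrite (extendsE eL).
  apply: vle_lt_trans k1 _ => //; rewrite -[iota k]mulr1.
  have -> : x - \sum_i iota (k * c i) * u i =
      iota k * (x / iota k - \sum_i iota (c i) * u i).
    rewrite mulrBr mulrCA mulfV // mulr1; congr (_ - _); rewrite mulr_sumr.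
    by apply: eq_bigr => i _; rewrite rmorphM mulrA.
  by apply: vltMl => //; apply/vmaxE.
move=> x x0; have [i [a [a0 ua]]] := cy x x0; have [y0 _] := oy.
have ia : iota a != 0 by rewrite fmorph_eq0.
have /vunitE[u1 u2] := ua.
have yi : y i != 0 := y0 i.
have Bx : B (x / y i).
  exists a; split; rewrite -[x / y i](divfK ia) -[X in vle _ _ X]mul1r ?[X in vle _ X]mul1r.
    rewrite -[x / y i / iota a]mulrA -invfM.
    by apply: vleMr.
  rewrite -[x / y i / iota a]mulrA -invfM mul1r -[X in vle _ X]mul1r.
  by apply: vleMr.
exists (fun j => if j == i then x / y i else 0); split=> [j|j|].
- by case: eqP => // _; exists 0; rewrite rmorph0; split; apply: vle_refl.
- by case: eqP => [->|_]; [rewrite divfK //; apply: vle_refl | rewrite mul0r; apply: vle0].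
rewrite (bigD1 i) //= eqxx divfK // big1 ?addr0 ?subrr; first exact: vlt0.
by move=> j /negbTE ->; rewrite mul0r.
Qed.

End RamificationResidue.

(** * Independence of characters modulo the maximal ideal *)

Section Characters.

Variables (L : fieldType) (O : L -> Prop).
Hypothesis vO : valuation_ring O.
Variables (X : Type) (one : X) (mul : X -> X -> X) (U : X -> Prop).
Hypotheses (U1 : U one) (UM : forall x y, U x -> U y -> U (mul x y)).
Variables (I : finType) (chi : I -> X -> L).
Hypothesis chiO : forall i x, U x -> O (chi i x).
Hypothesis chi1 : forall i, chi i one = 1.
Hypothesis chiM : forall i x y, U x -> U y -> chi i (mul x y) = chi i x * chi i y.

Definition char_eqv (i j : I) : bool :=
  `[< forall x, U x -> vmax O (chi i x - chi j x) >].

Lemma char_eqvP i j :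
  reflect (forall x, U x -> vmax O (chi i x - chi j x)) (char_eqv i j).
Proof. exact: asboolP. Qed.

(** Artin's argument for independence of characters, carried out modulo the maximal ideal. Different
    characters may be congruent there, so only the sums over congruence classes are forced to
    vanish. *)
Lemma char_class_sum (A : {set I}) (l : I -> L) :
  (forall i, O (l i)) -> (forall x, U x -> vmax O (\sum_(i in A) l i * chi i x)) ->
  forall i, i \in A -> vmax O (\sum_(j in A | char_eqv j i) l j).
Proof.
have [n le_n] := ubnP #|A|; elim: n A l le_n => // n IH A l.
rewrite ltnS => le_n Ol hl i iA.
have [/forallP h|] := boolP [forall j, (j \in A) ==> char_eqv j i].
  have := hl one U1; under eq_bigr do rewrite chi1 mulr1.
  rewrite (eq_bigl (fun j => (j \in A) && char_eqv j i)) // => j.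
  by have := h j; case: (j \in A).
rewrite negb_forall => /existsP[k]; rewrite negb_imply => /andP[kA nki].
have [y Uy ny] : exists2 y, U y & ~ vmax O (chi k y - chi i y).
  apply: contrapT => h; move/negP: nki; apply; apply/char_eqvP => x Ux.
  by apply: contrapT => nx; apply: h; exists x.
(* Replacing x by x y and subtracting chi_k(y) times the relation removes k. Modulo the maximal
   ideal the class of i only acquires the factor chi_i(y) - chi_k(y), a unit by the choice of y. *)
pose l' j := l j * (chi j y - chi k y).
have ki : k != i by apply: contraNneq nki => ->; apply/char_eqvP => x Ux; rewrite subrr; apply: vmax0.
have h1 : vmax O (\sum_(j in A :\ k | char_eqv j i) l' j).
  apply: (IH (A :\ k) l'); last by rewrite !inE eq_sym ki iA.
  - by have := cardsD1 k A; rewrite kA => e; rewrite e in le_n.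
  - by move=> j; apply: vringM => //; apply: vringB => //; apply: chiO.
  move=> x Ux.
  have -> : \sum_(j in A :\ k) l' j * chi j x =
      \sum_(j in A) l j * chi j (mul x y) - chi k y * \sum_(j in A) l j * chi j x.
    rewrite mulr_sumr -sumrB [RHS](big_setD1 k kA) /= chiM //.
    have -> : l k * (chi k x * chi k y) - chi k y * (l k * chi k x) = 0 by ring.
    by rewrite add0r; apply: eq_bigr => j _; rewrite /l' chiM //; ring.
  by apply: vmaxB => //; [apply/hl/UM | apply: vmaxMl => //; [apply: chiO | apply: hl]].
have eqs : \sum_(j in A :\ k | char_eqv j i) l' j =
    \sum_(j in A | char_eqv j i) l j * (chi j y - chi i y) +
    (chi i y - chi k y) * \sum_(j in A | char_eqv j i) l j.
  rewrite mulr_sumr -big_split /=; apply: eq_big => [j|j _]; last by rewrite /l'; ring.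
  by rewrite !inE; case: eqP => [->|//]; rewrite (negbTE nki) !andbF.
have Oik : O (chi i y - chi k y) by apply: vringB => //; apply: chiO.
have OS : O (\sum_(j in A | char_eqv j i) l j) by apply: vring_sum.
have : vmax O ((chi i y - chi k y) * \sum_(j in A | char_eqv j i) l j).
  rewrite -[X in vmax O X](addKr (\sum_(j in A | char_eqv j i) l j * (chi j y - chi i y))).
  rewrite -eqs; apply: vmaxD => //; apply: vmaxN => //; apply: vmax_sum => // j /andP[_ e].
  by apply: vmaxMl => //; apply: (char_eqvP _ _ e).
case/(vmaxM_prime vO Oik OS) => // m.
by case: ny; rewrite -opprB; apply: vmaxN.
Qed.

Lemma vring_det n (M : 'M[L]_n) : (forall i j, O (M i j)) -> O (\det M).
Proof.
move=> h; apply: vring_sum => // s _; apply: vringM => //; last exact: vring_prod.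
by apply: vringX => //; apply: vringN => //; apply: vring1.
Qed.

(* Expanding along the last row, the minors give a nontrivial relation between the first
   [k.+1] coordinates, so a new row making the determinant a unit exists. *)
Lemma ex_unit_det (F : X -> nat -> L) n :
  (forall x i, U x -> O (F x i)) ->
  (forall l : nat -> L, (forall i, O (l i)) ->
     (forall x, U x -> vmax O (\sum_(i < n) l i * F x i)) ->
     forall i, (i < n)%N -> vmax O (l i)) ->
  exists2 x : nat -> X, (forall i, U (x i)) & vunit O (\det (\matrix_(i < n, j < n) F (x i) j)).
Proof.
move=> FO ind.
suff H k : (k <= n)%N -> exists2 x : nat -> X, (forall i, U (x i)) &
    vunit O (\det (\matrix_(i < k, j < k) F (x i) j)) by apply: H.
elim: k => [_|k IH kn].
  by exists (fun _ => one) => //; rewrite det_mx00; apply: vunit1.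
have [x Ux ux] := IH (ltnW kn).
pose M y := \matrix_(i < k.+1, j < k.+1) F (if i == k :> nat then y else x i) j.
have MO y i j : U y -> O (M y i j).
  by move=> Uy; rewrite mxE; apply: FO; case: ifP.
have bumpk (a : 'I_k) : bump k a = a by rewrite /bump leqNgt ltn_ord.
(* The cofactors along the last row do not involve y, so det (M y) is a linear form in [F y] with
   fixed coefficients. *)
have cofE y j : cofactor (M y) ord_max j = cofactor (M one) ord_max j.
  rewrite /cofactor; congr (_ * \det _); apply/matrixP => a b; rewrite !mxE /=.
  by rewrite bumpk ltn_eqF.
pose l i := if insub i is Some j then cofactor (M one) ord_max j else 0.
have el (j : 'I_k.+1) : l j = cofactor (M one) ord_max j by rewrite /l valK.
have Ol i : O (l i).
  rewrite /l; case: insubP => [j _ _|_]; last exact: vring0.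
  apply: vringM => //.
    by apply: vringX => //; apply: vringN => //; apply: vring1.
  by apply: vring_det => a b; rewrite !mxE; apply: FO; case: ifP.
have lk : vunit O (l k).
  rewrite (el ord_max) /cofactor.
  have -> : \det (row' ord_max (col' ord_max (M one))) =
      \det (\matrix_(i < k, j < k) F (x i) j).
    congr (\det _); apply/matrixP => a b; rewrite !mxE /=.
    by rewrite !bumpk ltn_eqF.
  apply: vunitM => //; rewrite /= addnn -mul2n exprM sqrrN expr1n expr1n.
  exact: vunit1.
have [y Uy ny] : exists2 y, U y & ~ vmax O (\det (M y)).
  apply: contrapT => h; case: (lk) => _ _ Olk.
  pose lam i := if (i < k.+1)%N then l i else 0.
  have : vmax O (lam k).
    apply: ind => // [i|y Uy].
      by rewrite /lam; case: ifP => // _; apply: vring0.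
    apply: contrapT => ny; apply: h; exists y => // hy; apply: ny; move: hy.
    rewrite (expand_det_row _ ord_max) => hy.
    suff -> : \sum_(i < n) lam i * F y i =
        \sum_j M y ord_max j * cofactor (M y) ord_max j by [].
    under [RHS]eq_bigr do rewrite cofE -el mxE /= eqxx mulrC.
    rewrite (big_ord_widen n (fun j => l j * F y j) kn) [RHS]big_mkcond /=.
    by apply: eq_bigr => i _; rewrite /lam; case: ifP => //; rewrite mul0r.
  by rewrite /lam ltnSn; case=> _; apply.
exists (fun i => if i == k then y else x i); first by move=> i; case: ifP.
by case: (vring_maxVunit (vring_det (fun i j => MO y i j Uy))).
Qed.

(** Independence modulo the maximal ideal makes the matrix of characters invertible over O and not
    just over L. Its inverse D is integral, so passing to dual coordinates costs no value. *)
Lemma ex_dual_family : (forall i j, char_eqv i j -> i = j) ->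
  exists (w : I -> X) (D : I -> I -> L), [/\ forall i, U (w i), forall i j, O (D i j),
    forall g h, \sum_i chi g (w i) * D i h = (g == h)%:R &
    forall i j, \sum_g D i g * chi g (w j) = (i == j)%:R].
Proof.
move=> inj; pose n := #|I|.
pose F x k := if insub k : option 'I_n is Some j then chi (enum_val j) x else 0.
have FE x (i : I) : F x (enum_rank i) = chi i x by rewrite /F valK enum_rankK.
have [||x Ux ux] := @ex_unit_det F n.
- by move=> x i Ux; rewrite /F; case: insubP => [j _ _|_]; [apply: chiO | apply: vring0].
- move=> l Ol hl k kn.
  have := @char_class_sum [set: I] (fun i => l (enum_rank i)) _ _ (enum_val (Ordinal kn)).
  rewrite in_setT (eq_bigl (pred1 (enum_val (Ordinal kn)))); last first.
    move=> j; rewrite in_setT /=; apply/idP/eqP => [/inj //|->].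
    by apply/char_eqvP => y _; rewrite subrr; apply: vmax0.
  rewrite big_pred1_eq enum_valK; apply=> // y Uy.
  have := hl y Uy; rewrite (reindex _ (onW_bij _ (enum_rank_bij I))) /=.
  rewrite (eq_bigl (fun i => i \in [set: I])); last by move=> i; rewrite in_setT.
  by under eq_bigr do rewrite FE.
pose M := (\matrix_(i < n, j < n) F (x i) j)^T.
have dM : vunit O (\det M) by rewrite det_tr.
have MU : M \in unitmx by rewrite unitmxE unitfE; case: dM.
exists (fun i => x (enum_rank i)), (fun i h => invmx M (enum_rank i) (enum_rank h)).
split=> // [i j|g h|i j].
- rewrite /invmx MU !mxE; apply: vringM => //; first by case: dM.
  apply: vringM => //.
    by apply: vringX => //; apply: vringN => //; apply: vring1.
  apply: vring_det => a b; rewrite !mxE /F.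
  by case: insubP => [c _ _|_]; [apply: chiO | apply: vring0].
- have /matrixP/(_ (enum_rank g) (enum_rank h)) := mulmxV MU.
  rewrite [LHS]mxE [RHS]mxE (inj_eq enum_rank_inj) => <-.
  rewrite [RHS](reindex _ (onW_bij _ (enum_rank_bij I))) /=.
  by apply: eq_bigr => i _; rewrite !mxE FE.
have /matrixP/(_ (enum_rank i) (enum_rank j)) := mulVmx MU.
rewrite [LHS]mxE [RHS]mxE (inj_eq enum_rank_inj) => <-.
rewrite [RHS](reindex _ (onW_bij _ (enum_rank_bij I))) /=.
by apply: eq_bigr => g _; rewrite [M _ _]mxE [X in _ = _ * X]mxE FE.
Qed.

End Characters.

(** * Coarsening at p and approximate p-th roots *)

Section NatValuation.

Variables (L : fieldType) (O : L -> Prop).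
Hypothesis vO : valuation_ring O.

Lemma vmax_nat_prime n : (0 < n)%N -> vmax O n%:R ->
  exists2 l, prime l && (l %| n)%N & vmax O l%:R.
Proof.
have [m] := ubnP n; elim: m n => // m IH n; rewrite ltnS => le_n n0 mn.
have [n1|n1] := leqP n 1.
  have e : n = 1%N by apply/eqP; rewrite eqn_leq n1.
  by move: mn; rewrite e => /(vmaxNV1 vO).
have pl := pdiv_prime n1; have dl := pdiv_dvd n.
move: mn; rewrite -{1}(divnK dl) natrM => /(vmaxM_prime vO (vring_nat vO _) (vring_nat vO _)).
case=> h; last by exists (pdiv n); rewrite ?pl ?dl.
have [||l /andP[lp ld] ml] := IH (n %/ pdiv n)%N _ _ h.
- by apply: leq_trans le_n; rewrite ltn_Pdiv // prime_gt1.
- by rewrite divn_gt0 ?prime_gt0 // dvdn_leq.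
by exists l => //; rewrite lp; apply: dvdn_trans ld (dvdn_div dl).
Qed.

Lemma residue_char_uniq l p : prime l -> prime p -> vmax O l%:R -> vmax O p%:R -> l = p.
Proof.
move=> pl pp ml mp; apply/eqP; apply: contrapT => /negP ne.
have co : coprime l p by rewrite prime_coprime // dvdn_prime2.
have [u w e _] := egcdnP p (prime_gt0 pl).
apply: (vmaxNV1 vO).
have -> : (1 : L) = u%:R * l%:R - w%:R * p%:R.
  by rewrite -!natrM e (eqP co) natrD addrC addKr.
by apply: vmaxB => //; apply: vmaxMl => //; apply: vring_nat.
Qed.

End NatValuation.

(* p is the residue characteristic of O, possibly 0. *)
Definition rchar (L : fieldType) (O : L -> Prop) (p : nat) : Prop :=
  (prime p /\ vmax O p%:R) \/ (p = 0%N /\ forall l, prime l -> ~ vmax O l%:R).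

(* The overring O[1/p], which is the whole field when p = 0 in it. *)
Definition coarse (L : fieldType) (O : L -> Prop) (p : nat) (x : L) : Prop :=
  exists k, O (p%:R ^+ k * x).

Section Coarse.

Variables (L : fieldType) (O : L -> Prop) (p : nat).
Hypothesis vO : valuation_ring O.

Lemma vring_coarse x : O x -> coarse O p x.
Proof. by move=> Ox; exists 0%N; rewrite expr0 mul1r. Qed.

Lemma coarse_valuation : valuation_ring (coarse O p).
Proof.
split.
- by apply: vring_coarse; apply: vring1.
- move=> x y [k Ox] [l Oy]; exists (k + l)%N; rewrite exprD mulrBr.
  apply: vringB => //; first by rewrite mulrAC mulrC; apply: vringM => //; apply: vringX => //; apply: vring_nat.
  by rewrite -mulrA; apply: vringM => //; apply: vringX => //; apply: vring_nat.
- move=> x y [k Ox] [l Oy]; exists (k + l)%N.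
  by rewrite exprD mulrACA; apply: vringM.
by move=> x x0; case: (vringV vO x0) => h; [left|right]; apply: vring_coarse.
Qed.

Lemma vunit_coarse x : vunit O x -> vunit (coarse O p) x.
Proof. by case=> x0 Ox Ox'; split=> //; apply: vring_coarse. Qed.

Lemma rchar_nat_unit n : rchar O p -> (0 < n)%N -> ~~ (p %| n)%N -> vunit O n%:R.
Proof.
move=> rc n0 pn; case: (vring_maxVunit (vring_nat vO n)) => // mn.
have [l /andP[pl ln] ml] := vmax_nat_prime vO n0 mn.
case: rc => [[pp mp]|[_ /(_ l pl)//]].
by move: pn; rewrite -(residue_char_uniq vO pl pp ml mp) ln.
Qed.

End Coarse.

Lemma coarse_extends (K L : fieldType) (iota : {rmorphism K -> L}) O OL p :
  extends iota O OL -> extends iota (coarse O p) (coarse OL p).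
Proof.
move=> e x; split=> -[k h]; exists k; move: h.
  by rewrite -(rmorph_nat iota) -rmorphXn -rmorphM e.
by rewrite -(rmorph_nat iota) -rmorphXn -rmorphM e.
Qed.

Section ApproximateRoots.

Variables (K : fieldType) (O : K -> Prop) (p : nat).
Hypotheses (vO : valuation_ring O) (pK : perfect K) (gO : gdr O).
Hypotheses (pp : prime p) (mp : vmax O p%:R).

Let has_root b := exists2 z, z != 0 & unit1 O (b / z ^+ p).

Let has_rootM b c : has_root b -> has_root c -> has_root (b * c).
Proof.
move=> [y y0 uy] [z z0 uz]; exists (y * z); first exact: mulf_neq0.
by rewrite exprMn -mulf_div; apply: unit1M.
Qed.

Let has_rootV b : has_root b -> has_root b^-1.
Proof.
move=> [y y0 uy]; exists y^-1; first exact: invr_neq0.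
by rewrite exprVn invrK -[b^-1 * _]invrK invfM invrK; apply: unit1V.
Qed.

Let has_root1 : has_root 1.
Proof. by exists 1; rewrite ?oner_neq0 // expr1n divr1; apply: unit11. Qed.

Let has_rootX b k : has_root b -> has_root (b ^+ k).
Proof.
by move=> h; elim: k => [|k IH]; [exact: has_root1 | rewrite exprS; apply: has_rootM].
Qed.

(** (DRvr) gives y^p congruent to b modulo p in the completion. As v b < v p this already fixes the
    leading term, and y may be replaced by a nearby element of K. *)
Let has_root_small b : O b -> vlt O b p%:R -> has_root b.
Proof.
move=> Ob lt; have b0 := vlt_neq0 vO lt.
have [Kh [ih [Oh [[vh eh dense _] surj]]]] := gO.1 p (conj pp mp).
have Ob' : Oh (ih b) by rewrite (extendsE eh).
have [y [z [Oy Oz e]]] := surj _ Ob'.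
have ib0 : ih b != 0 by rewrite fmorph_eq0.
have uy : unit1 Oh (y ^+ p / ih b).
  apply/unit1_divE => //; apply: vlt_subC => //; rewrite e -(rmorph_nat ih).
  rewrite -[ih b]mulr1; apply: vlt_leM => //; first exact: oner_neq0.
    by rewrite (extends_vlt vO eh).
  exact: vring_vle.
have y0 : y != 0.
  apply: contraTneq (unit1_neq0 vh uy) => ->.
  by rewrite expr0n eqn0Ngt prime_gt0 // mul0r eqxx.
have [a ha] := dense y y y0.
have ua : unit1 Oh (ih a / y).
  by rewrite /unit1 -[_ - 1]opprB; apply: vmaxN => //; rewrite -(mulfV y0) -mulrBl.
exists a; first by apply: contraTneq (unit1_neq0 vh ua) => ->; rewrite rmorph0 mul0r eqxx.
rewrite -(extends_unit1 eh) fmorph_div rmorphXn; apply: unit1_div_sym => //.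
apply: (@unit1_div_trans _ _ vh (y ^+ p)) => //; first exact: expf_neq0.
by rewrite -expr_div_n; apply: unit1X.
Qed.

Lemma approx_root b : vunit (coarse O p) b -> exists2 z, z != 0 & unit1 O (b / z ^+ p).
Proof.
case=> b0 [k1 Ob] [k2 Ob'].
have [p0|p0] := eqVneq (p%:R : K) 0.
  have pch : p \in [pchar K] by rewrite inE pp p0 eqxx.
  have [z ez] := pK pch b; exists z; last by rewrite ez mulfV //; apply: unit11.
  by apply: contraNneq b0 => z0; rewrite -ez z0 expr0n eqn0Ngt prime_gt0.
(* By (DRvp) some x has 0 < v x < v p, and p is the product of x and p / x, both of value below v
   p. *)
have rp : has_root p%:R.
  have [x [mx [x0 nx]]] : exists x, vmax O x /\ x != 0 /\ ~ O (x / p%:R).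
    apply: contrapT => h; apply: (gO.2 p (conj pp mp)); split=> // x mx x0.
    by apply: contrapT => nx; apply: h; exists x.
  rewrite -(divfK x0 p%:R); apply: has_rootM; last first.
    apply: has_root_small; first exact: vmax_ring.
    by move=> le; apply: nx; apply/vle_divE.
  apply: has_root_small.
    by case: (vringV vO (mulf_neq0 p0 (invr_neq0 x0))) => //; rewrite invf_div.
  move=> le; case: mx => Ox []; split=> //; apply: vle_vring.
  by apply: (vleM2r vO p0); rewrite mul1r mulrC.
(* Values up to n v p are reached by splitting off factors p one at a time. *)
have claim n b' : b' != 0 -> O b' -> vle O b' (p%:R ^+ n) -> has_root b'.
  elim: n b' => [|n IH] b' b'0 Ob1 le.
    apply: has_root_small => //; apply: vle_lt_trans le _ => //; rewrite expr0; exact/vmaxE.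
  case: (vltVle O b' p%:R) => [|pb]; first exact: has_root_small.
  rewrite -(divfK p0 b'); apply: has_rootM => //; apply: IH.
  - by rewrite mulf_neq0 ?invr_neq0.
  - exact/vle_divE.
  by apply: (vleM2r vO p0); rewrite divfK // -exprSr.
have e : b = (p%:R ^+ k1 * b) * (p%:R ^+ k1)^-1 by rewrite mulrC mulKf // expf_neq0.
rewrite e; apply: has_rootM; last exact/has_rootV/has_rootX.
apply: (claim (k1 + k2)%N) => //; first by rewrite mulf_neq0 // expf_neq0.
rewrite exprD; apply: vleMl => //; exact/vle_divE.
Qed.

End ApproximateRoots.

(** An approximate root is again a unit of the coarsening, so the extraction can be repeated. *)
Lemma approx_root_pow (K : fieldType) (O : K -> Prop) (p : nat) k b :
  valuation_ring O -> perfect K -> gdr O -> prime p -> vmax O p%:R ->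
  vunit (coarse O p) b -> exists2 z, z != 0 & unit1 O (b / z ^+ (p ^ k)).
Proof.
move=> vO pK gO pp mp; elim: k b => [|k IH] b ub.
  by exists b; [case: ub | rewrite expr1 mulfV; [apply: unit11 | case: ub]].
have vc := coarse_valuation p vO.
have [y y0 uy] := approx_root vO pK gO pp mp ub.
have uyp : vunit (coarse O p) (y ^+ p).
  have -> : y ^+ p = b / (b / y ^+ p).
    by rewrite invf_div mulrCA mulfV ?mulr1 //; case: ub.
  by apply: vunitM => //; apply: vunitV; apply: vunit_coarse => //; apply: unit1_unit.
have uyc : vunit (coarse O p) y.
  case: uyp => _ h1 h2; split=> //; apply: (vring_expr vc (prime_gt0 pp)) => //.
  by rewrite exprVn.
have [z z0 uz] := IH y uyc; exists z => //.
apply: (@unit1_div_trans _ _ vO (y ^+ p)) => //; first exact: expf_neq0.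
by rewrite expnSr exprM -expr_div_n; apply: unit1X.
Qed.

Lemma coef_XD1n (R : nzRingType) n k : (('X + 1 : {poly R}) ^+ n)`_k = 'C(n, k)%:R.
Proof.
rewrite exprD1n coef_sum; have [lt|ge] := ltnP k n.+1.
  rewrite (bigD1 (Ordinal lt)) //= coefMn coefXn eqxx big1 ?addr0 // => i ik.
  by rewrite coefMn coefXn [k == i]eq_sym (negbTE (_ : i != k :> nat)) ?mul0rn.
rewrite bin_small // big1 // => i _; rewrite coefMn coefXn gtn_eqF ?mul0rn //.
exact: leq_trans ge.
Qed.

(* Compare the coefficients of X^q in (X + 1)^(q r) = (X^q + 1)^r modulo p. *)
Lemma bin_ppart_dvdn p n : prime p -> (0 < n)%N -> ~~ (p %| 'C(n, n`_p))%N.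
Proof.
move=> pp n0; pose q := (n`_p)%N; pose r := (n`_p^')%N.
have en : n = (q * r)%N by rewrite partnC.
have q0 : (0 < q)%N by apply: part_gt0.
have pch : p \in [pchar 'F_p] by rewrite pchar_Fp.
have e : ('X + 1 : {poly 'F_p}) ^+ n = (('X + 1) ^+ r) \Po 'X^q.
  rewrite [in LHS]en exprM rmorphXn rmorphD /= comp_polyX comp_polyC; congr (_ ^+ _).
  rewrite exprDn_pchar ?expr1n //.
  by apply: sub_in_pnat (part_pnat p n) => l _ /eqnP ->; rewrite pchar_poly.
have := coef_XD1n 'F_p n q.
rewrite e coef_comp_poly_Xn // dvdnn divnn q0 coef_XD1n bin1 => er.
rewrite (dvdn_pcharf pch) -er -(dvdn_pcharf pch) -prime_coprime //.
by have := part_pnat p^' n; rewrite -/r p'natE ?part_gt0 // -prime_coprime.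
Qed.

(** * Approximation in extensions with trivial coarse ramification *)

(** The coefficients are elementary symmetric functions of s. Measuring the error against d^i,
    without the binomial coefficient, keeps the induction valid when p divides that coefficient. *)
Lemma vlt_coef_prod (L : fieldType) (O : L -> Prop) (d : L) (s : seq L) :
  valuation_ring O -> d != 0 -> {in s, forall t, vlt O d (t - d)} ->
  forall i, vlt O (d ^+ i)
    ((\prod_(t <- s) (1 + t *: 'X))`_i - 'C(size s, i)%:R * d ^+ i).
Proof.
move=> vO d0; elim: s => [_ i|t s IH hs i].
  rewrite big_nil coef1 bin0n; case: i => [|i] /=.
    by rewrite expr0 mulr1 subrr; apply: vlt0; apply: oner_neq0.
  by rewrite mul0r subr0; apply: vlt0; apply: expf_neq0.
have td : vlt O d (t - d) by apply: hs; rewrite mem_head.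
have {}IH := IH (fun u us => hs u (mem_behead (s := t :: s) us)).
rewrite big_cons mulrDl mul1r -scalerAl coefD coefZ coefXM /=.
case: i => [|i] /=; first by rewrite mulr0 addr0 !bin0; have := IH 0%N; rewrite bin0.
set Q := \prod_(j <- s) _ in IH *.
rewrite binS natrD mulrDl.
have -> : Q`_i.+1 + t * Q`_i - ('C(size s, i.+1)%:R * d ^+ i.+1 + 'C(size s, i)%:R * d ^+ i.+1)
  = (Q`_i.+1 - 'C(size s, i.+1)%:R * d ^+ i.+1) +
    (t * (Q`_i - 'C(size s, i)%:R * d ^+ i) + (t - d) * ('C(size s, i)%:R * d ^+ i)).
  by rewrite exprS; ring.
apply: vltD => //; apply: vltD => //; rewrite exprS.
  by have [dt _] := vlt_subl vO (vlt_subC vO td); apply: vle_ltM.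
apply: vlt_leM => //; first exact: expf_neq0.
rewrite -[X in vle _ X]mul1r; apply: vleMr => //; apply: vring_vle; exact: vring_nat.
Qed.

Section Approximation.

Variables (K : fieldType) (O : K -> Prop) (p : nat).
Hypotheses (vO : valuation_ring O) (amO : algebraically_maximal O) (gO : gdr O).
Hypotheses (pK : perfect K) (rc : rchar O p).
Variables (N : splittingFieldType K) (O1 : N -> Prop).
Hypotheses (v1 : valuation_ring O1) (e1 : extends (in_alg N) O O1).
Variable E : {subfield N}.
Hypothesis galE : galois 1%AS E.

Let galN : galois 1%AS {:N} := perfect_galois N pK.
Local Notation G := 'Gal(E / 1%AS)%g.

Lemma rchar_ext : rchar O1 p.
Proof.
have mE l : vmax O1 l%:R = vmax O l%:R.
  by rewrite -(rmorph_nat (in_alg N)) (extends_vmax e1).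
case: rc => [[pp mp]|[p0 nl]]; [left | right]; rewrite ?mE; split=> // l pl.
by rewrite mE; apply: nl.
Qed.

Lemma gal_vle_in g x : g \in G -> x \in E -> vle O1 x (g x).
Proof.
move=> gG xE; apply: (conj_vle vO amO galN v1 e1).
exact: root_minPoly_gal (sub1v _) gG xE.
Qed.

Lemma gal_vge_in g x : g \in G -> x \in E -> vle O1 (g x) x.
Proof.
move=> gG xE.
have {2}<- : (g^-1)%g (g x) = x by rewrite -galM // mulgV gal_id.
by apply: gal_vle_in; rewrite ?groupV ?memv_gal.
Qed.

Lemma gal_base_in g a : g \in G -> (g : gal_of E) a%:A = a%:A.
Proof. by move=> gG; apply: (fixed_gal (sub1v _) gG); apply/memv1P; exists a. Qed.

Lemma gal_fixed_base x : x \in E -> (forall g, g \in G -> g x = x) -> exists a : K, x = a%:A.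
Proof.
move=> xE fx; apply/memv1P.
have : x \in fixedField G by apply/fixedFieldP.
by rewrite (galois_fixedField galE).
Qed.

(* The q-th elementary symmetric function of the conjugates of d is close to
   'C(#|G|, q) d^q, and q is a p-power such that this binomial coefficient is a unit. *)
Lemma ex_power_approx d : d \in E -> d != 0 ->
  (forall g, g \in G -> vlt O1 d (g d - d)) ->
  exists k (b : K), unit1 O1 (b%:A / d ^+ (p ^ k)) /\ (p = 0%N -> k = 0%N).
Proof.
move=> dE d0 dg; pose n := #|G|; pose q := (n`_p)%N.
have n0 : (0 < n)%N by apply: cardG_gt0.
(* For p = 0 this is 0 and q = 1, so that b is the mean of the conjugates of d. *)
exists (logn p n).
pose P := \prod_(g in G) (1 + (g : gal_of E) d *: 'X).
have PE i : P`_i \in E.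
  have : P \is a polyOver E.
    apply: rpred_prod => g gG; apply: rpredD; first exact: rpred1.
    by apply: polyOverZ; [apply: memv_gal | apply: polyOverX].
  by move/polyOverP.
have [b eb] : exists b : K, P`_q = b%:A.
  apply: gal_fixed_base => // h hG.
  suff eP : map_poly h P = P by rewrite -[in RHS]eP coef_map.
  rewrite rmorph_prod [RHS](reindex_inj (mulIg h)) /=.
  apply: eq_big => [g|g gG]; first by rewrite groupMr.
  by rewrite rmorphD rmorph1 /= map_polyZ map_polyX galM.
have lt : vlt O1 (d ^+ q) (b%:A - 'C(n, q)%:R * d ^+ q).
  rewrite -eb /n cardE -(size_map (fun g : gal_of E => g d)).
  have -> : P = \prod_(t <- [seq (g : gal_of E) d | g <- enum G]) (1 + t *: 'X).
    by rewrite big_map big_enum.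
  apply: vlt_coef_prod => // t /mapP[g]; rewrite mem_enum => gG ->; exact: dg.
have uC : vunit O1 'C(n, q)%:R.
  apply: (rchar_nat_unit v1 rchar_ext).
    by rewrite bin_gt0 dvdn_leq // dvdn_part.
  case: rc => [[pp _]|[p0 _]]; first exact: bin_ppart_dvdn.
  by rewrite p0 dvd0n -lt0n bin_gt0 dvdn_leq // dvdn_part.
exists (b / 'C(n, q)%:R); split; last first.
  by move=> p0; rewrite p0 lognE.
have C0 : 'C(n, q)%:R != 0 :> N by case: uC.
have dq0 : d ^+ q != 0 by apply: expf_neq0.
rewrite -p_part -/q (_ : (b / 'C(n, q)%:R)%:A = b%:A / 'C(n, q)%:R); last first.
  by rewrite -[LHS]/(in_alg N _) fmorph_div rmorph_nat.
apply/unit1_divE => //.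
have -> : b%:A / 'C(n, q)%:R - d ^+ q = 'C(n, q)%:R^-1 * (b%:A - 'C(n, q)%:R * d ^+ q).
  by rewrite mulrBr mulKf // mulrC.
rewrite -[X in vlt _ X]mul1r; apply: vle_ltM => //; first exact: oner_neq0.
by apply: vring_vle; case: uC.
Qed.

Hypothesis HE : forall x, x \in E -> x != 0 ->
  exists2 c : K, c != 0 & vunit (coarse O1 p) (x / c%:A).

(** Suppose the best approximation y0 were worse than mu. By [HE] some c in K scales a - y0 to a
    unit d of the coarsening, still close to its conjugates. A power of d has the leading term of
    some b in K, and with an approximate root z of b the element y0 + c z improves on y0. *)
Lemma gal_approx a mu : a \in E -> (forall g, g \in G -> vle O1 mu (g a - a)) ->
  exists y : K, vle O1 mu (a - y%:A).
Proof.
move=> aE ha; have [y0 hy0] := base_approx vO amO v1 e1 a.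
exists y0; case: (vltVle O1 (a - y0%:A) mu) => // lt.
have y0E : y0%:A \in E by apply: memvZ; apply: mem1v.
have a0 := vlt_neq0 v1 lt; have a'E : a - y0%:A \in E by apply: rpredB.
have [c c0 uc] := HE a'E a0.
have cA0 : c%:A != 0 :> N by rewrite -[c%:A]/(in_alg N c) fmorph_eq0.
pose d := (a - y0%:A) / c%:A.
have cE : c%:A \in E by apply: memvZ; apply: mem1v.
have dE : d \in E by apply: rpred_div.
have d0 : d != 0 by case: uc.
have [g gG|k [b [ub k0]]] := ex_power_approx dE d0.
  have -> : g d - d = (g a - a) / c%:A.
    by rewrite /d fmorph_div rmorphB /= !gal_base_in // -mulrBl; congr (_ / _); ring.
  apply: vltMr => //; first exact: invr_neq0.
  by apply: vlt_le_trans lt (ha g gG).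
(* b is a unit of the coarsening because d is. Injectivity of Frobenius on residues takes the
   comparison of p^k-th powers back to d and z; for p = 0, b itself serves. *)
have [z z0 uz] : exists2 z : K, z != 0 & unit1 O1 (d / z%:A).
  have vc := coarse_valuation p v1.
  case: rc => [[pp mp]|[p0 _]]; last first.
    exists b; last by apply: unit1_div_sym => //; have := ub; rewrite k0.
    by apply: contraTneq (unit1_neq0 v1 ub) => ->; rewrite scale0r mul0r eqxx.
  have ubc : vunit (coarse O p) b.
    rewrite -(extends_vunit (coarse_extends p e1)) /=.
    have -> : b%:A = b%:A / d ^+ (p ^ k) * d ^+ (p ^ k) by rewrite divfK // expf_neq0.
    apply: vunitM => //; first by apply: vunit_coarse => //; apply: unit1_unit.
    elim: (p ^ k)%N => [|m IHm]; first exact: vunit1.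
    by rewrite exprS; apply: vunitM.
  have [z z0 uz] := approx_root_pow k vO pK gO pp mp ubc.
  exists z => //; apply: (unit1_root (k := k) v1 pp).
    by rewrite -(rmorph_nat (in_alg N)) (extends_vmax e1).
  rewrite expr_div_n; apply: (@unit1_div_trans _ _ v1 b%:A).
  - by apply: contraTneq (unit1_neq0 v1 ub) => ->; rewrite mul0r eqxx.
  - exact: unit1_div_sym.
  by move: uz; rewrite -(extends_unit1 e1) fmorph_div rmorphXn.
case: (@vlt_irr _ _ v1 (a - y0%:A)).
apply: vlt_le_trans (hy0 (y0 + c * z)) => //.
have zA0 : z%:A != 0 :> N by rewrite -[z%:A]/(in_alg N z) fmorph_eq0.
have -> : a - (y0 + c * z)%:A = c%:A * (d - z%:A).
  rewrite mulrBr [c%:A * d]mulrC /d divfK // scalerDl opprD addrA; congr (_ - _).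
  by rewrite -[LHS]/(in_alg N _) rmorphM.
have -> : a - y0%:A = c%:A * d by rewrite mulrC divfK.
apply: vltMl => //; apply: vlt_subC => //; apply/unit1_divE => //.
exact: unit1_div_sym.
Qed.

End Approximation.

(** * The ramification group *)

(** The ramification group. No decomposition group has to be singled out since all automorphisms
    preserve the valuation. It is used for O1 and for the coarsening, where it is trivial. *)
Definition ram_group (K : fieldType) (N : splittingFieldType K) (O1 : N -> Prop)
    (E : {subfield N}) : {set gal_of E} :=
  [set s in 'Gal(E / 1%AS)%g |
    `[< forall x, x \in E -> x != 0 -> unit1 O1 ((s : gal_of E) x / x) >]].

Section RamGroup.

Variables (K : fieldType) (N : splittingFieldType K) (O1 : N -> Prop).
Hypothesis v1 : valuation_ring O1.
Variable E : {subfield N}.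
Local Notation G := 'Gal(E / 1%AS)%g.
Local Notation V := (ram_group O1 E).

Lemma ram_groupP s : reflect (s \in G /\
  forall x, x \in E -> x != 0 -> unit1 O1 (s x / x)) (s \in V).
Proof.
rewrite inE; apply: (iffP andP) => -[sG]; first by move/asboolP.
by move=> h; split=> //; apply/asboolP.
Qed.

Lemma ram_group_set : group_set V.
Proof.
apply/group_setP; split.
  apply/ram_groupP; split=> [|x xE x0]; first exact: group1.
  by rewrite gal_id mulfV //; apply: unit11.
move=> s t /ram_groupP[sG hs] /ram_groupP[tG ht]; apply/ram_groupP; split.
  exact: groupM.
move=> x xE x0; rewrite galM //; apply: (@unit1_div_trans _ _ v1 (s x)).
- by rewrite fmorph_eq0.
- by apply: ht; rewrite ?memv_gal ?fmorph_eq0.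
exact: hs.
Qed.

Let Vg : {group gal_of E} := Group ram_group_set.

Lemma unit1_sum_nat l (F : 'I_l -> N) :
  (forall i, unit1 O1 (F i)) -> vmax O1 (\sum_i F i) -> vmax O1 l%:R.
Proof.
move=> hF mF.
have -> : l%:R = \sum_i F i - \sum_i (F i - 1).
  by rewrite sumrB opprB addrC subrK sumr_const card_ord.
by apply: vmaxB => //; apply: vmax_sum => // i _; apply: hF.
Qed.

(** Let s in V have order l. An element y of trace 0 under s that is not 0 would make l, modulo the
    maximal ideal, equal to the sum 0 of the 1-units s^i y / y. If l is a unit, then a - tr a / l =
    0 for all a, so s is trivial. *)
Lemma ram_group_prime l : prime l -> (l %| #|V|)%N -> vmax O1 l%:R.
Proof.
move=> pl dl; apply: contrapT => nl.
have [s sV os] := Cauchy pl (dl : (l %| #|Vg|)%N).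
have l0 : l%:R != 0 :> N by apply/eqP => e; apply: nl; rewrite e; apply: vmax0.
have siV i : (s ^+ i)%g \in Vg by apply: groupX.
have sE i a : a \in E -> s ((s ^+ i)%g a) = (s ^+ i.+1)%g a.
  by move=> aE; rewrite expgSr galM.
have fix_s a : a \in E -> s a = a.
  move=> aE; pose tr b := \sum_(i < l) (s ^+ i)%g b.
  have str b : b \in E -> s (tr b) = tr b.
    move=> bE; rewrite /tr rmorph_sum /=.
    under eq_bigr do rewrite sE //.
    have : (0 < l)%N := prime_gt0 pl; have := os; case: (l) => // m osm _.
    rewrite big_ord_recr [RHS]big_ord_recl /= -osm expg_order addrC expg0.
    by congr (_ + _); apply: eq_bigr => i _; rewrite /bump leq0n add1n.
  have trE b : b \in E -> tr b \in E.
    by move=> bE; apply: rpred_sum => i _; apply: memv_gal.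
  have lE : l%:R \in E by apply: rpred_nat.
  have tlE : tr a / l%:R \in E by apply: rpred_div => //; apply: trE.
  have yE : a - tr a / l%:R \in E by apply: rpredB.
  have stl : s (tr a / l%:R) = tr a / l%:R by rewrite fmorph_div rmorph_nat /= str.
  have sitl i : (s ^+ i)%g (tr a / l%:R) = tr a / l%:R.
    elim: i => [|i IH]; first by rewrite expg0 gal_id.
    by rewrite -sE // IH stl.
  have [/eqP|y0] := eqVneq (a - tr a / l%:R) 0; first by rewrite subr_eq0 => /eqP ->.
  case: nl; apply: (@unit1_sum_nat l (fun i => (s ^+ i)%g (a - tr a / l%:R) / (a - tr a / l%:R))).
    by move=> i; have /ram_groupP[_ h] := siV i; apply: h.
  rewrite -mulr_suml.
  under eq_bigr do rewrite rmorphB /= sitl.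
  rewrite sumrB sumr_const card_ord -[_ *+ l]mulr_natr divfK // -/(tr a) subrr mul0r.
  exact: vmax0.
have s1 : s = 1%g by apply/eqP/gal_eqP => a aE; rewrite gal_id fix_s.
by move: os (prime_gt1 pl); rewrite s1 order1 => <-.
Qed.

Lemma ram_group_card p : rchar O1 p -> exists2 k, #|V| = (p ^ k)%N & (p = 0%N -> k = 0%N).
Proof.
move=> rc; have V0 : (0 < #|V|)%N := cardG_gt0 Vg.
case: rc => [[pp mp]|[p0 nl]]; last first.
  exists 0%N => //; rewrite expn0; apply/eqP; rewrite eqn_leq V0 andbT leqNgt; apply/negP => V1.
  exact: nl (pdiv_prime V1) (ram_group_prime (pdiv_prime V1) (pdiv_dvd _)).
have /p_natP[k ek] : (p.-nat #|V|)%N.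
  rewrite /pnat V0; apply/allP => l; rewrite mem_primes => /and3P[pl _ ld].
  by apply/eqP; apply: (residue_char_uniq v1 pl pp _ mp); apply: ram_group_prime.
by exists k => // p0; rewrite p0 in pp.
Qed.

End RamGroup.

(** * The tame part and the triviality of the ramification group *)

Section TameExtension.

Variables (K : fieldType) (O : K -> Prop) (p : nat).
Hypotheses (vO : valuation_ring O) (amO : algebraically_maximal O) (gO : gdr O).
Hypotheses (pK : perfect K) (rc : rchar O p).
Variables (N : splittingFieldType K) (O1 : N -> Prop).
Hypotheses (v1 : valuation_ring O1) (e1 : extends (in_alg N) O O1).
Variable E : {subfield N}.
Hypothesis galE : galois 1%AS E.

Local Notation G := 'Gal(E / 1%AS)%g.
Let V : {group gal_of E} := Group (ram_group_set v1 E).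
Let T : {subfield N} := [aspace of fixedField V].
(** By [galM], v acts first in v * g, so the members of a right coset of V agree on T: the cosets
    stand for the embeddings of T over K. *)
Let I := {C : {set gal_of E} | C \in rcosets V G}.
Let rp (C : I) : gal_of E := repr (val C).
Let chi (C : I) (x : N) : N := rp C x / x.
Let U (x : N) : Prop := x \in T /\ x != 0.

Let gle g x (gG : g \in G) (xE : x \in E) : vle O1 x (g x) :=
  gal_vle_in vO amO pK v1 e1 gG xE.
Let gge g x (gG : g \in G) (xE : x \in E) : vle O1 (g x) x :=
  gal_vge_in vO amO pK v1 e1 gG xE.

Let glt g x y : g \in G -> x \in E -> y \in E -> vlt O1 x y -> vlt O1 (g x) (g y).
Proof.
move=> gG xE yE lt.
exact (vlt_le_trans v1 (vle_lt_trans v1 (gge gG xE) lt) (gle gG yE)).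
Qed.

Let g_unit1 g u : g \in G -> u \in E -> unit1 O1 u -> unit1 O1 (g u).
Proof.
move=> gG uE /(vmaxE v1) lt; apply/vmaxE => //.
rewrite -[X in vlt _ X](rmorph1 g) -[X in _ - X](rmorph1 g) -rmorphB /=.
have u1E : u - 1 \in E by rewrite rpredB ?mem1v.
exact (glt gG (mem1v _) u1E lt).
Qed.

Let VG : {subset V <= G}. Proof. by move=> s /(ram_groupP O1)[]. Qed.
Let TE : {subset T <= E}. Proof. exact/subvP/fixedField_bound. Qed.
Let VT v x : v \in V -> x \in T -> v x = x.
Proof. by move=> vV /mem_fixedFieldP[_]; apply. Qed.

Let rp_coset (C : I) : val C = (V :* rp C)%g.
Proof. by have /rcosetsP[g gG e] := valP C; rewrite /rp e rcoset_repr. Qed.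

Let rpG (C : I) : rp C \in G.
Proof.
have /rcosetsP[g gG e] := valP C; rewrite /rp e.
have := mem_repr_rcoset V g; rewrite mem_rcoset => /VG h.
by rewrite -(groupMr _ (groupVr gG)).
Qed.

Let coset_on_T (C : I) g x : g \in val C -> x \in T -> g x = rp C x.
Proof.
rewrite rp_coset => /rcosetP[v vV ->] xT; rewrite galM ?TE //.
by rewrite (VT vV xT).
Qed.

Let mem_mkI g : g \in G -> (V :* g)%g \in rcosets V G.
Proof. by move=> gG; apply/rcosetsP; exists g. Qed.

Let mkI g (gG : g \in G) : I := exist _ (V :* g)%g (mem_mkI gG).

Let U1 : U 1. Proof. by split; [apply: mem1v | apply: oner_neq0]. Qed.

Let UM x y : U x -> U y -> U (x * y).
Proof. by move=> [xT x0] [yT y0]; split; [apply: rpredM | apply: mulf_neq0]. Qed.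

Let chiO C x : U x -> O1 (chi C x).
Proof. by move=> [xT x0]; apply/vle_divE => //; apply: gle; rewrite ?TE. Qed.

Let chi1 C : chi C 1 = 1. Proof. by rewrite /chi rmorph1 divr1. Qed.

Let chiM C x y : U x -> U y -> chi C (x * y) = chi C x * chi C y.
Proof. by move=> _ _; rewrite /chi rmorphM mulf_div. Qed.

(* The norm over V maps E to T, and it is the #|V|-th power up to 1-units. *)
Let unit1_T_ram s : s \in G -> (forall x, U x -> unit1 O1 (s x / x)) -> s \in V.
Proof.
move=> sG hs; apply/ram_groupP; split=> // x xE x0.
pose M := \prod_(t in V) (t : gal_of E) x.
have tx0 (t : gal_of E) : t x != 0 by rewrite fmorph_eq0.
have ME : M \in E by apply: rpred_prod => t _; apply: memv_gal.
have MT : M \in T.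
  apply/fixedFieldP => // v vV; rewrite /M rmorph_prod [RHS](reindex_inj (mulIg v)).
  by apply: eq_big => [t|t _]; [rewrite (groupMr _ vV) | rewrite galM].
have M0 : M != 0 by rewrite prodf_seq_neq0; apply/allP => t _; rewrite tx0 implybT.
pose u := \prod_(t in V) ((t : gal_of E) x / x).
have eM : M = u * x ^+ #|V| by rewrite /u prodf_div prodr_const divfK // expf_neq0.
have uu : unit1 O1 u.
  by apply: unit1_prod => // t /(ram_groupP O1)[_]; apply.
have uE : u \in E by apply: rpred_prod => t _; apply: rpred_div => //; apply: memv_gal.
have u0 := unit1_neq0 v1 uu.
have su := g_unit1 sG uE uu.
have su0 := unit1_neq0 v1 su.
have [k ek k0] := ram_group_card v1 E (rchar_ext rc e1).
have upow : unit1 O1 ((s x / x) ^+ (p ^ k)).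
  rewrite -ek -[#|ram_group O1 E|]/#|V|.
  have -> : (s x / x) ^+ #|V| = (s M / M) * (u / s u).
    rewrite eM rmorphM rmorphXn /= -mulf_div -expr_div_n mulrAC mulf_div [u * s u]mulrC.
    by rewrite (mulfV (mulf_neq0 su0 u0)) mul1r.
  by apply: unit1M => //; [apply: hs | apply: unit1M => //; apply: unit1V].
case: rc => [[pp mp]|[p0 _]].
  apply: (unit1_root (k := k) v1 pp) => //.
  by rewrite -(rmorph_nat (in_alg N)) (extends_vmax e1).
by move: upow; rewrite k0 // expn0 expr1.
Qed.

(** If the characters are congruent, the quotient of the representatives moves elements of T by
    1-units only, hence lies in V by [unit1_T_ram]. *)
Let chi_inj C C' : char_eqv O1 U chi C C' -> C = C'.
Proof.
move=> /char_eqvP h; apply: val_inj; rewrite !rp_coset.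
have gG := rpG C; have gG' := rpG C'.
pose s := (rp C * (rp C')^-1)%g.
have sG : s \in G by rewrite groupM ?groupV.
suff sV : s \in V.
  by apply/rcoset_eqP; rewrite mem_rcoset.
apply: unit1_T_ram => // x Ux; have [xT x0] := Ux; have xE := TE xT.
apply/unit1_divE => //.
have lt : vlt O1 (rp C' x) (rp C x - rp C' x).
  apply: vle_lt_trans (gge gG' xE) _ => //.
  by apply/vmax_divE => //; rewrite mulrBl; apply: h.
have gV : ((rp C')^-1)%g \in G by rewrite groupV.
have := glt gV _ _ lt; rewrite rmorphB /= -!galM // mulgV gal_id; apply.
  exact: memv_gal.
by apply: rpredB; apply: memv_gal.
Qed.

(** This inverts the matrix of conjugates of the w j. For b j in K the inner sums are conjugates of
    the single element sum of w j b j, so D recovers each term from that element without loss of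
    value. *)
Let dual_expand (w : I -> N) (D : I -> I -> N) (b : I -> N) i : (forall i, U (w i)) ->
  (forall i j, \sum_g D i g * chi g (w j) = (i == j)%:R) ->
  w i * b i = \sum_C D i C * \sum_j rp C (w j) * b j.
Proof.
move=> Uw eD; transitivity (\sum_j w j * b j * \sum_C D i C * chi C (w j)).
  rewrite (bigD1 i) //= eD eqxx mulr1 big1 ?addr0 // => j ji.
  by rewrite eD eq_sym (negbTE ji) mulr0.
under eq_bigr do rewrite mulr_sumr.
rewrite exchange_big; apply: eq_bigr => C _ /=.
rewrite mulr_sumr; apply: eq_bigr => j _; have [_ w0] := Uw j.
rewrite mulrCA /chi; congr (_ * _); rewrite mulrC mulrA; congr (_ * _).
by rewrite divfK.
Qed.

Let w_vorth (w : I -> N) (D : I -> I -> N) : (forall i, U (w i)) ->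
  (forall i j, O1 (D i j)) -> (forall i j, \sum_g D i g * chi g (w j) = (i == j)%:R) ->
  vorth O1 (vbase (in_alg N)) w.
Proof.
move=> Uw OD eD; split=> [i|a /choice[b ab] i]; first by case: (Uw i).
set x := \sum_j a j * w j.
have aE j : a j \in E by rewrite ab; apply: memvZ; apply: mem1v.
have wE j : w j \in E by apply: TE; case: (Uw j).
have xE : x \in E by apply: rpred_sum => j _; apply: rpredM.
have -> : a i * w i = \sum_C D i C * rp C x.
  rewrite mulrC (dual_expand a i Uw eD); apply: eq_bigr => C _.
  rewrite /x rmorph_sum; congr (_ * _); apply: eq_bigr => j _.
  by rewrite rmorphM /= ab gal_base_in ?rpG // mulrC.
apply: vle_sum => // C _; rewrite -[X in vle _ X]mul1r; apply: vleM => //.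
  exact: vring_vle.
exact: gle.
Qed.

Hypothesis HE : forall x, x \in E -> x != 0 ->
  exists2 c : K, c != 0 & vunit (coarse O1 p) (x / c%:A).

(* Otherwise pick eta in E moved by V with mu the least value of [t eta - eta]. The dual
   family expresses eta through the traces [eta_i] of [w i * eta], and approximating these by
   elements of K gives x in T with [v (eta - x) >= mu], so that [eta - x] is moved too much. *)
Lemma ram_group_trivial : V :=: 1%g.
Proof.
apply/trivgP/subsetP => s sV; rewrite inE; apply/gal_eqP => eta etaE.
rewrite gal_id; apply/eqP; apply: contrapT => /negP seta.
have [t0 t0V tmin] := @ex_vmin _ _ v1 _ (enum V) (fun t : gal_of E => t eta - eta) s
  (etrans (mem_enum _ _) sV).
rewrite mem_enum in t0V; set mu := t0 eta - eta in tmin.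
have {}tmin t : t \in V -> vle O1 mu (t eta - eta) by move=> tV; apply: tmin; rewrite mem_enum.
have mu0 : mu != 0.
  apply: contraNneq seta => e; have := tmin s sV; rewrite e => /vle0l /eqP.
  by rewrite subr_eq0.
have muE : mu \in E by apply: rpredB => //; apply: memv_gal.
have [w [D [Uw OD eD1 eD2]]] := ex_dual_family v1 U1 UM chiO chi1 chiM chi_inj.
have wT i : w i \in T by case: (Uw i).
have wE i : w i \in E by apply: TE.
have w0 i : w i != 0 by case: (Uw i).
(* For eta in T this would be the trace of [w i * eta]. In general it depends on the
   representatives, and h in G changes it by conjugates of elements w i (t eta - eta) with t in V,
   none of value below that of w i mu. *)
pose et i := \sum_C rp C (w i * eta).
have etE i : et i \in E by apply: rpred_sum => C _; apply: memv_gal; apply: rpredM.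
have [y hy] : exists y : I -> K, forall i, vle O1 (w i * mu) (et i - (y i)%:A).
  suff /choice[y hy] : forall i, exists y : K, vle O1 (w i * mu) (et i - y%:A) by exists y.
  move=> i; apply: (gal_approx vO amO gO pK rc v1 e1 galE HE) => // h hG.
  have fG (C : I) : (rp C * h)%g \in G by rewrite groupM ?rpG.
  pose f (C : I) : I := mkI (fG C).
  have finj : injective f.
    move=> C C' eC; apply: val_inj; rewrite !rp_coset; apply/rcoset_eqP.
    have : (rp C * h)%g \in (V :* (rp C' * h))%g by apply/rcoset_eqP; apply: (congr1 val eC).
    by rewrite !mem_rcoset invMg mulgA mulgK.
  rewrite /et rmorph_sum /= [X in _ - X](reindex_inj finj) -sumrB /=.
  apply: vle_sum => // C _.
  have yE : w i * eta \in E by apply: rpredM.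
  have [t tV et'] : exists2 t, t \in V & (rp C * h = t * rp (f C))%g.
    have : (rp C * h)%g \in val (f C) by apply: rcoset_refl.
    by rewrite rp_coset => /rcosetP[t tV ->]; exists t.
  rewrite -galM // et' galM // -rmorphB.
  have -> : t (w i * eta) - w i * eta = w i * (t eta - eta).
    by rewrite rmorphM /= (VT tV (wT i)) mulrBr.
  have tE : t eta - eta \in E by apply: rpredB => //; apply: memv_gal.
  apply: vle_trans (gle (rpG _) _) => //; last exact: rpredM.
  by apply: vleMl => //; apply: tmin.
pose C1 : I := mkI (group1 _).
have rpC1 : rp C1 = 1%g by rewrite /rp [val C1](rcoset1 V) repr_group.
(* This is the dual basis of w for the trace form of T, obtained from the column of D at the
   identity coset. *)
pose d i := D i C1 / w i.
have dsum C : \sum_i rp C (w i) * d i = (C == C1)%:R.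
  rewrite -eD1; apply: eq_bigr => i _; by rewrite /d /chi mulrA mulrAC.
have duniq (c : I -> N) : (forall C, \sum_i rp C (w i) * c i = (C == C1)%:R) -> c =1 d.
  move=> hc i.
  by apply: (mulfI (w0 i)); rewrite !(dual_expand _ i Uw eD2); apply: eq_bigr => C _; rewrite hc dsum.
have galTN : galois T {:N}.
  by apply: galoisS (perfect_galois N pK); rewrite sub1v subvf.
have cosetE g : ((V :* g)%g == (V :* 1)%g) = (g \in V).
  by apply/eqP/idP => [/rcoset_eqP|h]; [|apply/rcoset_eqP]; rewrite mem_rcoset invg1 mulg1.
(* D is only known to have entries in N, so invariance is checked under Gal(N / T). Such a tau
   restricts to some v in V and permutes the equations that determine d. *)
have dT i : d i \in T.
  rewrite -(galois_fixedField galTN); apply/fixedFieldP; first exact: memvf.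
  move=> tau tauG; move: i; apply: duniq => C.
  have [sTE sEN] : (T <= E)%VS /\ (E <= {:N})%VS by rewrite fixedField_bound subvf.
  have tau1 : tau \in 'Gal({:N} / 1%AS)%g by apply: subsetP tauG; apply/galS/sub1v.
  have nE : normalField 1%AS E by case/and3P: galE.
  have s1EN : (1 <= E <= {:N})%VS by rewrite sub1v subvf.
  pose v : gal_of E := normalField_cast E tau.
  have vE := normalField_cast_eq s1EN nE tau1.
  have vV : v \in V.
    rewrite -(gal_fixedField V) gal_kHom //; apply/kAHomP => z zT.
    by rewrite vE ?TE //; apply: (fixed_gal (subvf _) tauG zT).
  have hG : (rp C * v^-1)%g \in G by rewrite groupM ?rpG // groupV VG.
  pose C' : I := mkI hG.
  have := congr1 tau (dsum C'); rewrite rmorph_sum rmorph_nat /=.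
  have -> : (C' == C1) = (C == C1).
    transitivity ((rp C * v^-1)%g \in V); first by rewrite -val_eqE; apply: cosetE.
    by rewrite (groupMr _ (groupVr vV)) -val_eqE [val C]rp_coset; symmetry; apply: cosetE.
  move=> <-; apply: eq_bigr => i _; rewrite [RHS]rmorphM; congr (_ * _) => /=.
  rewrite -vE ?memv_gal // -galM //; symmetry; apply: coset_on_T => //.
  have : rp C' \in (V :* (rp C * v^-1))%g.
    by rewrite -[(V :* _)%g]/(val C') [val C']rp_coset rcoset_refl.
  by rewrite [val C]rp_coset !mem_rcoset invMg invgK mulgA.
pose x := \sum_i (y i)%:A * d i.
have xT : x \in T.
  by apply: rpred_sum => i _; apply: rpredM => //; apply: memvZ; apply: mem1v.
have ex : eta - x = \sum_i d i * (et i - (y i)%:A).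
  under eq_bigr do rewrite mulrBr.
  rewrite sumrB; congr (_ - _); last by apply: eq_bigr => i _; rewrite mulrC.
  rewrite /et; under eq_bigr do rewrite mulr_sumr.
  rewrite exchange_big /= (bigD1 C1) //= [X in _ + X]big1 ?addr0 => [|C nC].
    transitivity ((\sum_i rp C1 (w i) * d i) * rp C1 eta).
      by rewrite dsum eqxx mul1r rpC1 gal_id.
    rewrite mulr_suml; apply: eq_bigr => i _.
    by rewrite [rp C1 (w i * eta)]rmorphM [RHS]mulrCA [RHS]mulrA.
  transitivity ((\sum_i rp C (w i) * d i) * rp C eta).
    rewrite mulr_suml; apply: eq_bigr => i _.
    by rewrite [rp C (w i * eta)]rmorphM [LHS]mulrCA [LHS]mulrA.
  by rewrite dsum (negbTE nC) mul0r.
(* The product d i w i is an entry of D, hence integral, which absorbs the factor w i in the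
   precision of [et i]. *)
have lex : vle O1 mu (eta - x).
  rewrite ex; apply: vle_sum => // i _; apply: vle_trans (vleMl v1 (d i) (hy i)) => //.
  rewrite mulrA /d divfK // -[X in vle _ X]mul1r; apply: vleMr => //; exact: vring_vle.
have exE : eta - x \in E by apply: rpredB => //; apply: TE.
have tx : t0 (eta - x) - (eta - x) = mu.
  by rewrite rmorphB /= (VT t0V xT) /mu; ring.
have ex0 : eta - x != 0.
  apply: contraNneq mu0 => e; rewrite -tx e rmorph0 subrr //.
have /(ram_groupP O1)[_ h] := t0V.
have := h _ exE ex0 => /unit1_divE -/(_ v1 ex0).
rewrite tx; exact.
Qed.

(** As V is trivial, there are [E : K] cosets, so the family indexed by them has full length. *)
Lemma tame_vorth : exists (J : finType) (w : J -> N),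
  [/\ #|J| = \dim E, forall i, w i \in E & vorth O1 (vbase (in_alg N)) w].
Proof.
have [w [D [Uw OD _ eD]]] := ex_dual_family v1 U1 UM chiO chi1 chiM chi_inj.
exists I, w; split; last exact: w_vorth Uw OD eD.
  rewrite card_sig (eq_card (_ : _ =i rcosets V G)) //.
  rewrite -[#|rcosets V G|]/#|G : V|%g ram_group_trivial indexg1 -(galois_dim galE).
  by rewrite dimv1 divn1.
by move=> i; apply: TE; case: (Uw i).
Qed.

End TameExtension.

(** * Valuation bases of Galois extensions *)

Lemma mem_gal1 (K : fieldType) (N : splittingFieldType K) (E : {subfield N}) (g : gal_of E) :
  g \in 'Gal(E / 1%AS)%g.
Proof. by rewrite gal_kHom ?sub1v // k1AHom. Qed.

(** * Passage to the inertia field of the coarsening *)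

Section CoarseInertia.

Variables (K : fieldType) (O : K -> Prop) (p : nat).
Hypotheses (vO : valuation_ring O) (amO : algebraically_maximal O) (gO : gdr O).
Hypotheses (pK : perfect K) (pp : prime p) (mp : vmax O p%:R) (p0 : p%:R != 0 :> K).
Variables (N : splittingFieldType K) (O1 : N -> Prop).
Hypotheses (v1 : valuation_ring O1) (e1 : extends (in_alg N) O O1).

Local Notation G := 'Gal({:N} / 1%AS)%g.
Let O0 : N -> Prop := coarse O1 p.
Let v0 : valuation_ring O0 := coarse_valuation p v1.
Let galN : galois 1%AS {:N} := perfect_galois N pK.

Let p0N : p%:R != 0 :> N. Proof. by rewrite -(rmorph_nat (in_alg N)) fmorph_eq0. Qed.

Let rchar0 : rchar O0 0.
Proof.
right; split=> // l pl ml0.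
have up : vunit O0 p%:R.
  split=> //; first by apply: vring_coarse; apply: vring_nat.
  by exists 1%N; rewrite expr1 mulfV //; apply: vring1.
have mp1 : vmax O1 p%:R by rewrite -(rmorph_nat (in_alg N)) (extends_vmax e1).
case: (vring_maxVunit (vring_nat v1 l)) => hl; last first.
  by case: ml0 => _; apply; apply: vunit_coarse.
by move: ml0; rewrite (residue_char_uniq v1 pl pp hl mp1) => -[].
Qed.

Let nat_unit0 n : (0 < n)%N -> vunit O0 n%:R.
Proof. by move=> n0; apply: (rchar_nat_unit v0 rchar0) => //; rewrite dvd0n -lt0n. Qed.

Let gal_ring0 (g : gal_of {:N}) x : O0 x -> O0 (g x).
Proof.
case=> k h; exists k; have := gal_vle_in vO amO pK v1 e1 (mem_gal1 g) (memvf (p%:R ^+ k * x)).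
rewrite rmorphM rmorphXn rmorph_nat /= => le; apply: vle_vring; apply: vle_trans le => //.
exact: vring_vle.
Qed.

Let gal_extends0 (g : gal_of {:N}) : extends g O0 O0.
Proof.
move=> x; split; last exact: gal_ring0.
move/(gal_ring0 (g^-1)%g); rewrite -galM ?memvf // mulgV gal_id //.
Qed.

Let inertia : {set gal_of {:N}} :=
  [set s in G | `[< forall x, O0 x -> vmax O0 ((s : gal_of {:N}) x - x) >]].

Let inertiaP (s : gal_of {:N}) : reflect (forall x, O0 x -> vmax O0 (s x - x)) (s \in inertia).
Proof. by rewrite inE mem_gal1; apply: asboolP. Qed.

Let inertia_group_set : group_set inertia.
Proof.
apply/group_setP; split.
  by apply/inertiaP => x _; rewrite gal_id subrr; apply: vmax0.
move=> s t /inertiaP hs /inertiaP ht; apply/inertiaP => x Ox.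
rewrite galM ?memvf // -[t (s x)](subrK (s x)) -addrA.
by apply: vmaxD => //; [apply/ht/gal_ring0 | apply: hs].
Qed.

Let I0 : {group gal_of {:N}} := Group inertia_group_set.

Let I0_normal : (I0 <| G)%g.
Proof.
apply/andP; split; apply/subsetP => g; first by rewrite mem_gal1.
move=> _; rewrite inE; apply/subsetP => s; rewrite mem_conjg => /inertiaP h.
apply/inertiaP => x Ox; have := h _ (gal_ring0 (g^-1)%g Ox).
rewrite conjgE invgK !galM ?memvf // -[g ((g^-1)%g x)]galM ?memvf // mulVg gal_id -rmorphB.
by rewrite (extends_vmax (gal_extends0 _)).
Qed.

Let E : {subfield N} := [aspace of fixedField I0].

Let galE : galois 1%AS E.
Proof. exact (normal_fixedField_galois galN I0_normal). Qed.

Let E_fixed s x : s \in I0 -> x \in E -> s x = x.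
Proof. by move=> sI /mem_fixedFieldP[_]; apply. Qed.

(** The multipliers l g = g x / x are 1 on the inertia group, whose order is a unit in residue
    characteristic 0. So independence of characters gives u for which the sum of l g times g u, that
    is Tr(x u) / x, is a unit of O0, and this trace is the required c. *)
Let E_coarse x : x \in E -> x != 0 ->
  exists2 c : K, c != 0 & vunit (coarse O1 p) (x / c%:A).
Proof.
move=> xE x0; pose l (g : gal_of {:N}) := g x / x.
have Ol g : O0 (l g).
  apply: vring_coarse; apply/vle_divE => //.
  exact (gal_vle_in vO amO pK v1 e1 (mem_gal1 g) (memvf x)).
pose ch (g : gal_of {:N}) (u : N) : N := g u.
have [u Ou nu] : exists2 u, O0 u & ~ vmax O0 (\sum_(g in [set: gal_of {:N}]) l g * ch g u).
  apply: contrapT => h.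
  have := @char_class_sum _ _ v0 N 1 *%R O0 (vring1 v0) (@vringM _ _ v0) _ ch _ _ _
    [set: gal_of {:N}] l Ol.
  move=> /(_ gal_ring0 (fun g => rmorph1 g) (fun g x y _ _ => rmorphM g x y)).
  have h' y : O0 y -> vmax O0 (\sum_(g in [set: gal_of {:N}]) l g * ch g y).
    by move=> Oy; apply: contrapT => ny; apply: h; exists y.
  move=> /(_ h' 1%g (in_setT _)).
  rewrite (eq_bigl (fun g => g \in I0)); last first.
    move=> g; rewrite in_setT /=; apply/char_eqvP/inertiaP => hg z Oz; have := hg z Oz;
      by rewrite /ch gal_id.
  rewrite (eq_bigr (fun _ => 1)); last by move=> g gI; rewrite /l (E_fixed gI xE) mulfV.
  rewrite sumr_const; have := nat_unit0 (cardG_gt0 I0); by move=> ? [].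
have [a ea] : exists a : K, \sum_(g in G) (g : gal_of {:N}) (x * u) = a%:A.
  apply/memv1P; exact: (mem_galTrace galN (memvf (x * u))).
have eS : \sum_(g in [set: gal_of {:N}]) l g * ch g u = a%:A / x.
  rewrite -ea mulr_suml; apply: eq_big => g; first by rewrite in_setT mem_gal1.
  by move=> _; rewrite rmorphM /l /ch mulrAC.
have uS : vunit O0 (a%:A / x).
  have OS : O0 (a%:A / x).
    by rewrite -eS; apply: vring_sum => // g _; apply: vringM => //; apply: gal_ring0.
  by case: (vring_maxVunit OS) => //; rewrite -eS.
exists a; last by rewrite -invf_div; apply: vunitV.
by apply: contraTneq (vunit_neq0 uS) => ->; rewrite scale0r mul0r eqxx.
Qed.

Let J := {s : gal_of {:N} | s \in I0}.
Let chi (s : J) (x : N) : N := val s x / x.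
Let U (x : N) : Prop := x != 0.

Let chiO s x : U x -> O0 (chi s x).
Proof.
move=> x0; apply: vring_coarse; apply/vle_divE => //.
exact (gal_vle_in vO amO pK v1 e1 (mem_gal1 _) (memvf x)).
Qed.

(** Congruent characters differ by an element of the ramification group of O0, which is trivial in
    residue characteristic 0. *)
Let chi_inj s t : char_eqv O0 U chi s t -> s = t.
Proof.
move=> /char_eqvP h; apply: val_inj; apply/eqP; rewrite eq_mulgV1; apply/eqP.
have [k] := ram_group_card v0 {:N}%AS rchar0; move=> + /(_ erefl) k0; rewrite k0 expn0 => cV.
pose V := Group (ram_group_set v0 {:N}%AS).
have /trivgP/subsetP V1 : V :=: 1%g by apply: card1_trivg.
apply/eqP; rewrite -in_set1; apply: V1; apply/ram_groupP; split=> [|x _ x0].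
  exact: mem_gal1.
rewrite galM ?memvf //; apply/unit1_divE => //.
have {1 3}-> : x = ((val t)^-1)%g (val t x) by rewrite -galM ?memvf // mulgV gal_id.
rewrite -rmorphB (extends_vlt v0 (gal_extends0 _)).
have le : vle O0 (val t x) x.
  have tx0 : val t x != 0 by rewrite fmorph_eq0.
  apply/vle_divE => //; apply: vring_coarse; apply/vle_divE => //.
  exact (gal_vge_in vO amO pK v1 e1 (mem_gal1 _) (memvf x)).
apply: vle_lt_trans le _ => //; apply/vmax_divE => //.
by rewrite mulrBl; apply: h.
Qed.

(* If two terms had the same value, their quotient z would be a unit of O1, hence of O0, and
   [s z / z] would be a 1-unit of O0 for all s in the inertia group. *)
Let w_vorth : exists w : J -> N, vorth O1 (fun x => x \in E) w.
Proof.
have U1 : U 1 by apply: oner_neq0.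
have UM x y : U x -> U y -> U (x * y) by apply: mulf_neq0.
have chi1 s : chi s 1 = 1 by rewrite /chi rmorph1 divr1.
have chiM s x y : U x -> U y -> chi s (x * y) = chi s x * chi s y.
  by rewrite /chi rmorphM mulf_div.
have [w [D [w0 OD _ eD]]] := ex_dual_family v0 U1 UM chiO chi1 chiM chi_inj.
exists w; split=> // a aE; apply: vle_sum_distinct => // i j ij.
rewrite !mulf_eq0 !negb_or => /andP[ai0 _] /andP[aj0 _].
have ti0 : a i * w i != 0 by rewrite mulf_neq0 ?w0.
have tj0 : a j * w j != 0 by rewrite mulf_neq0 ?w0.
case: (vltVle O1 (a i * w i) (a j * w j)) => [|le1]; first by left.
case: (vltVle O1 (a j * w j) (a i * w i)) => [|le2]; first by right.
pose z := a i * w i / (a j * w j).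
have uz : vunit O0 z.
  apply: vunit_coarse; split; first by rewrite mulf_neq0 ?invr_neq0.
    exact/vle_divE.
  by rewrite invf_div; apply/vle_divE.
have z0 := vunit_neq0 uz.
have chiz s : chi s (w i) = chi s (w j) * (val s z / z).
  have swj0 : val s (w j) != 0 by rewrite fmorph_eq0 w0.
  have wj0 : w j != 0 := w0 j.
  have wi0 : w i != 0 := w0 i.
  have -> : val s z = a i * val s (w i) / (a j * val s (w j)).
    by rewrite /z fmorph_div !rmorphM /= !(E_fixed (valP s) (aE _)).
  rewrite /chi /z; move: (val s (w i)) (val s (w j)) swj0 => b c c0.
  by field; rewrite ai0 aj0 wi0 wj0 c0.
have eqv s : vmax O0 (chi s (w i) - chi s (w j)).
  rewrite chiz -{2}[chi s (w j)]mulr1 -mulrBr; apply: vmaxMl => //; first exact: chiO.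
  rewrite -(mulfV z0) -mulrBl; apply: vmaxMr => //; last by case: uz.
  by apply: (inertiaP _ (valP s)); case: uz.
case: (vmaxNV1 v0).
have -> : 1 = \sum_s D i s * (chi s (w i) - chi s (w j)).
  under eq_bigr do rewrite mulrBr.
  by rewrite sumrB !eD eqxx (negbTE ij) subr0.
by apply: vmax_sum => // s _; apply: vmaxMl.
Qed.

Lemma galois_vorth_mixed : exists (I : finType) (w : I -> N),
  #|I| = \dim {:N} /\ vorth O1 (vbase (in_alg N)) w.
Proof.
have [I [z [cI zE oz]]] := tame_vorth vO amO gO pK (or_introl (conj pp mp)) v1 e1 galE E_coarse.
have [w ow] := w_vorth.
exists (I * J)%type, (fun ij => z ij.1 * w ij.2); split.
  rewrite card_prod cI card_sig (eq_card (_ : _ =i I0)) // (dim_fixedField I0) mulnC.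
  by rewrite -dim_sup_field ?subvf.
apply: vorth_comp oz ow => // a Aa; apply: rpred_sum => i _; apply: rpredM => //.
by have [b ->] := Aa i; apply: memvZ; apply: mem1v.
Qed.

End CoarseInertia.

Lemma galois_vorth (K : fieldType) (O : K -> Prop) (N : splittingFieldType K) (O1 : N -> Prop) :
  valuation_ring O -> algebraically_maximal O -> gdr O -> perfect K ->
  valuation_ring O1 -> extends (in_alg N) O O1 ->
  exists (I : finType) (w : I -> N), #|I| = \dim {:N} /\ vorth O1 (vbase (in_alg N)) w.
Proof.
move=> vO amO gO pK v1 e1.
have [p rc] : exists p, rchar O p.
  case: (pselect (exists p, prime p /\ vmax O p%:R)) => [[p h]|h]; first by exists p; left.
  by exists 0%N; right; split=> // l pl ml; apply: h; exists l.
(* If p is 0 in K, which includes residue characteristic 0, the coarsening is the whole field and E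
   = N can be taken. *)
have trivial_coarse : p%:R = 0 :> K ->
    exists (I : finType) (w : I -> N), #|I| = \dim {:N} /\ vorth O1 (vbase (in_alg N)) w.
  move=> p0; have pN : p%:R = 0 :> N by rewrite -(rmorph_nat (in_alg N)) p0 rmorph0.
  have HE (x : N) : x \in {:N}%AS -> x != 0 ->
      exists2 c : K, c != 0 & vunit (coarse O1 p) (x / c%:A).
    move=> _ x0; exists 1; first exact: oner_neq0.
    rewrite scale1r divr1; split=> //; exists 1%N; rewrite pN expr1 mul0r; exact: vring0.
  have [I [w [cI _ ow]]] := tame_vorth vO amO gO pK rc v1 e1 (perfect_galois N pK) HE.
  by exists I, w.
case: (rc) => [[pp mp]|[p0 _]]; last by apply: trivial_coarse; rewrite p0.
have [|p0] := eqVneq (p%:R : K) 0; first exact: trivial_coarse.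
exact: (galois_vorth_mixed vO amO gO pK pp mp p0 v1 e1).
Qed.

(** * Defectlessness *)

Lemma indep_card_le_dim (K : fieldType) (N : fieldExtType K) (I : finType) (z : I -> N) :
  (forall c : I -> K, \sum_i c i *: z i = 0 -> forall i, c i = 0) -> (#|I| <= \dim {:N})%N.
Proof.
move=> ind; rewrite leqNgt; apply/negP => lt.
have lt' : (#|'I_(\dim {:N})| < #|I|)%N by rewrite card_ord.
have [c [[i ci] hc]] := ex_kernel_vector (fun i k => coord (vbasis {:N}) k (z i)) lt'.
case/eqP: ci; apply: ind.
under eq_bigr => k _ do rewrite (coord_vbasis (memvf (z k))) scaler_sumr.
rewrite exchange_big big1 //= => k _.
under eq_bigr do rewrite scalerA.
by rewrite -scaler_suml hc scale0r.
Qed.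

Lemma vorth_card_le_dim (K : fieldType) (L : fieldExtType K) OL (I : finType) (z : I -> L) :
  vorth OL (vbase (in_alg L)) z -> (#|I| <= \dim {:L})%N.
Proof.
move=> [z0 oz]; apply: (@indep_card_le_dim _ _ _ z) => c sc i.
have cB k : vbase (in_alg L) ((c k)%:A : L) by exists (c k).
have := oz (fun k => (c k)%:A) cB i.
rewrite (eq_bigr (fun k => c k *: z k)) ?sc => [|k _]; last by rewrite -scalerAl mul1r.
move=> /vle0l/eqP; rewrite -scalerAl mul1r scaler_eq0 (negbTE (z0 i)) orbF.
by move/eqP.
Qed.

Lemma vorth_tower_le_dim (K : fieldType) (L N : fieldExtType K) (j : {rmorphism L -> N}) ON
    (I : finType) (z : I -> N) : (forall a : K, j a%:A = a%:A) ->
  vorth ON (vbase j) z -> (#|I| * \dim {:L} <= \dim {:N})%N.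
Proof.
move=> jA [z0 oz].
have jZ (k : K) x : j (k *: x) = k *: j x.
  by rewrite -[x in LHS]mul1r scalerAl rmorphM jA -scalerAl mul1r.
have := @indep_card_le_dim K N (I * 'I_(\dim {:L}))%type
  (fun ik => z ik.1 * j (vbasis {:L})`_ik.2).
rewrite card_prod card_ord; apply=> c sc [i k].
pose l i := \sum_k c (i, k) *: (vbasis {:L})`_k.
have sl : \sum_i j (l i) * z i = 0.
  rewrite -[RHS]sc; under eq_bigr do rewrite /l rmorph_sum mulr_suml.
  rewrite pair_bigA; apply: eq_bigr => -[u w] _ /=.
  by rewrite jZ -scalerAl mulrC.
have := oz (fun i => j (l i)) (fun i => ex_intro _ (l i) erefl) i.
rewrite sl => /vle0l/eqP; rewrite mulf_eq0 (negbTE (z0 i)) orbF fmorph_eq0 => /eqP li0.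
have /freeP := basis_free (vbasisP {:L}); apply: (fun f => f (fun k => c (i, k)) _ k).
by [].
Qed.

(** Let e f belong to L over K and e' f' to N over L. Generation of leading terms gives [N : K] <= e
    f e' f', and independence gives e' f' [L : K] <= [N : K]; hence [L : K] <= e f. The sum over
    extensions has one term because K is henselian. *)
Lemma amax_gdr_defectless (K : fieldType) (O : K -> Prop) :
  valuation_ring O -> algebraically_maximal O -> gdr O -> perfect K -> defectless O.
Proof.
move=> vO amO gO pK L iota.
have alg : algebraic (in_alg L).
  move=> y; have [q eq] := polyOver1P (minPolyOver 1%AS y); exists q.
  rewrite -eq root_minPoly; split=> //.
  by rewrite -(map_poly_eq0 (in_alg L)) -eq monic_neq0 ?monic_minPoly.
have [OL [vL eL uL]] := amax_henselian vO amO pK alg.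
have [N [j jA]] := ex_normal_closure L.
have [O1 [v1 ej]] := valuation_extends j vL.
have e1 : extends (in_alg N) O O1.
  move=> a; have -> : in_alg N a = j a%:A by rewrite jA.
  by rewrite (extendsE ej); apply: eL.
have [I [w [cI ow]]] := galois_vorth vO amO gO pK v1 e1.
have bdL n (z : 'I_n -> L) : vorth OL (vbase (in_alg L)) z -> (n <= \dim {:L})%N.
  by move/vorth_card_le_dim; rewrite card_ord.
have bdN n (z : 'I_n -> N) : vorth O1 (vbase j) z -> (n <= \dim {:N})%N.
  move/(vorth_tower_le_dim jA); rewrite card_ord; apply: leq_trans.
  by rewrite leq_pmulr // adim_gt0.
have [e [f [z [re rf oz sz]]]] := ex_ramification_residue vO vL eL bdL.
have [e' [f' [z' [_ _ oz' sz']]]] := ex_ramification_residue vL v1 ej bdN.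
have sN : vspan O1 (vbase (in_alg N)) (fun k => j (z k.1) * z' k.2).
  apply: (@vspan_comp _ _ v1 _ (vbase j) _ _ (fun k => j (z k)) z') => //.
    by exists 0; rewrite rmorph0.
  move=> _ [y ->]; rewrite fmorph_eq0 => y0; have [a [Aa h1 h2]] := sz y y0.
  exists (fun i => j (a i)); split=> [i|i|].
  - by have [b ->] := Aa i; exists b; rewrite /= jA.
  - by rewrite -rmorphM (extends_vle vL ej).
  have -> : j y - \sum_i j (a i) * j (z i) = j (y - \sum_i a i * z i).
    by rewrite rmorphB rmorph_sum; congr (_ - _); apply: eq_bigr => i _; rewrite rmorphM.
  by rewrite (extends_vlt vL ej).
have le1 := vorth_le_vspan v1 ow sN.
have le2 := vorth_tower_le_dim jA oz'.
have le3 := vorth_card_le_dim oz.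
rewrite cI !card_prod !card_ord in le1; rewrite card_prod !card_ord in le2.
rewrite card_prod !card_ord in le3.
have dN : (0 < \dim {:N})%N by apply: adim_gt0.
have dL : \dim {:L} = (e * f)%N.
  move: (\dim {:L}) (\dim {:N}) dN le1 le2 le3 => l n dN le1 le2 le3.
  have s2 : (0 < f' * e')%N by move: le1; case: (f' * e')%N => //; rewrite muln0; lia.
  apply/eqP; rewrite eqn_leq [(e * f)%N]mulnC le3 andbT.
  rewrite -(leq_pmul2l s2); apply: leq_trans le2 _; apply: leq_trans le1 _.
  by rewrite [X in (_ <= X)%N]mulnC.
exists 1%N, (fun _ => OL), (fun _ => e), (fun _ => f); split=> //.
- by move=> i k _; rewrite !ord1.
- by move=> OL' vL' eL'; exists ord0; apply: uL.
by rewrite big_ord1.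
Qed.

Theorem theorem1p8 (K : fieldType) (O : K -> Prop) :
  valuation_ring O -> algebraically_maximal O -> gdr O ->
  perfect K /\ henselian O /\ defectless O.
Proof.
move=> vO amO gO; have pK := amax_perfect vO amO gO.1.
split=> //; split; first exact: amax_henselian.
exact: amax_gdr_defectless.
Qed.
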